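(* Let $G$ be an unmixed bipartite graph of dimension $d-1$ which is not Cohen-Macaulay. Let $K_{n,n}$, with $n\ge 2$, be a maximal complete bipartite subgraph of $G$ of minimum dimension. Then $G$ is $\mathrm{CM}_{d-n+1}$ but it is not $\mathrm{CM}_{d-n}$.
   Context: All graphs are finite and simple; Cohen-Macaulayness of simplicial complexes is over a fixed field. The independence complex $\mathrm{Ind}(G)$ of a graph $G$ is the simplicial complex on the vertex set of $G$ whose faces are the independent sets of vertices. The dimension of $G$ is $\dim \mathrm{Ind}(G)$ (so $\dim K_{n,n}=n-1$). $G$ is unmixed if $\mathrm{Ind}(G)$ is pure. A graph is bipartite if its vertex set is a disjoint union $V_1\cup V_2$ with every edge joining a vertex of $V_1$ to a vertex of $V_2$; if $\#V_1=m$, $\#V_2=n$ and all pairs in $V_1\times V_2$ are edges, it is the complete bipartite graph $K_{m,n}$. For an integer $t\ge 0$, a simplicial complex $\Delta$ is $\mathrm{CM}_t$ if it is pure and $\mathrm{link}_\Delta(F)$ is Cohen-Macaulay for every face $F\in\Delta$ with $\#F\ge t$. A graph $G$ is $\mathrm{CM}_t$ if $\mathrm{Ind}(G)$ is $\mathrm{CM}_t$, and $G$ is Cohen-Macaulay if $\mathrm{Ind}(G)$ is (equivalently, if $G$ is $\mathrm{CM}_0$).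
   Formalization: The complete bipartite subgraphs K_{n,n} considered are only those whose two parts are matched to each other by a perfect matching of the non-isolated vertices of G, maximal and minimum (with n≥2) being taken among these; for arbitrary K_{n,n} the claim is false. *)

(* Defs.v *)
From mathcomp Require Import all_boot all_order all_algebra.
From mathcomp Require Import mpoly.

Set Implicit Arguments.
Unset Strict Implicit.
Unset Printing Implicit Defensive.

Import GRing.Theory.
Local Open Scope ring_scope.

Section Ideals.
Variable R : comNzRingType.

Definition is_ideal (I : R -> Prop) : Prop :=
  [/\ I 0, forall x y, I x -> I y -> I (x + y) & forall a x, I x -> I (a * x)].

Definition prime_ideal (P : R -> Prop) : Prop :=
  [/\ is_ideal P, ~ P 1 & forall x y, P (x * y) -> P x \/ P y].

Definition ideal_gen (A : R -> Prop) : R -> Prop :=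
  fun x => forall I, is_ideal I -> (forall a, A a -> I a) -> I x.

(* I + (s) *)
Definition ideal_add_seq (I : R -> Prop) (s : seq R) : R -> Prop :=
  ideal_gen (fun x => I x \/ x \in s).

(* P 0 < P 1 < ... < P h, all prime and containing I, that is, a chain of
   length h of prime ideals of R / I. *)
Definition prime_chain (I : R -> Prop) (h : nat) (P : nat -> R -> Prop) : Prop :=
  (forall i, (i <= h)%N -> prime_ideal (P i) /\ (forall x, I x -> P i x)) /\
  (forall i, (i < h)%N ->
     (forall x, P i x -> P i.+1 x) /\ (exists x, P i.+1 x /\ ~ P i x)).

(* The Krull dimension of R / I is d. *)
Definition krull_dim_quot (I : R -> Prop) (d : nat) : Prop :=
  (exists P, prime_chain I d P) /\
  (forall h P, prime_chain I h P -> (h <= d)%N).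

(* s is a regular sequence on the R-module R / I. *)
Definition regular_seq (I : R -> Prop) (s : seq R) : Prop :=
  (forall i, (i < size s)%N -> forall g,
     ideal_add_seq I (take i s) (s`_i * g) -> ideal_add_seq I (take i s) g) /\
  ~ ideal_add_seq I s 1.

End Ideals.

Section GradedCohenMacaulay.
Variables (k : fieldType) (n : nat).
Implicit Type I : {mpoly k[n]} -> Prop.

Definition homog_regular_seq I (s : seq {mpoly k[n]}) : Prop :=
  regular_seq I s /\
  (forall f, f \in s -> exists2 c : nat, (0 < c)%N & f \is c.-homog).

Definition depth_quot I (r : nat) : Prop :=
  (exists2 s, homog_regular_seq I s & size s = r) /\
  (forall s, homog_regular_seq I s -> (size s <= r)%N).

(* For a proper homogeneous ideal I: the standard graded k-algebra
   k[X_1..X_n] / I is Cohen-Macaulay, that is, its depth (the maximal length of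
   a regular sequence of homogeneous elements of positive degree) is equal to
   its Krull dimension. *)
Definition CM_quot I : Prop :=
  exists d, krull_dim_quot I d /\ depth_quot I d.

End GradedCohenMacaulay.

Section Complexes.
Variable T : finType.
(* A simplicial complex on T is given by its set of faces. *)
Implicit Type D : {set {set T}}.

Definition link D (F : {set T}) : {set {set T}} :=
  [set H : {set T} | [disjoint H & F] && (H :|: F \in D)].

Definition facet D (F : {set T}) : bool := maxset [pred H : {set T} | H \in D] F.

Definition pure D : Prop :=
  forall F H : {set T}, facet D F -> facet D H -> #|F| = #|H|.

(* An integer, as the dimension of the complex {set0} is -1. *)
Definition sdim D : int := (\max_(F in D) #|F|)%:Z - 1.

Variable k : fieldType.

Definition face_monomial (F : {set T}) : {mpoly k[#|T|]} :=
  \prod_(v in F) 'X_(enum_rank v).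

(* An element v of T that is not a vertex of D contributes the generator X_v,
   so the quotient is the Stanley-Reisner ring of D on its own vertex set. In
   particular the quotient for a link does not depend on the ground set. *)
Definition stanley_reisner_ideal D : {mpoly k[#|T|]} -> Prop :=
  ideal_gen (fun p => exists2 F, F \notin D & p = face_monomial F).

Definition cohen_macaulay D : Prop := CM_quot (stanley_reisner_ideal D).

Definition CM_t (t : nat) D : Prop :=
  pure D /\
  (forall F, F \in D -> (t <= #|F|)%N -> cohen_macaulay (link D F)).

End Complexes.

Section Graphs.
Variables (V : finType) (e : rel V).

Definition simple_graph : Prop := ssrbool.symmetric e /\ irreflexive e.

Definition Ind : {set {set V}} :=
  [set F : {set V} | [forall u in F, forall v in F, ~~ e u v]].

Definition unmixed : Prop := pure Ind.

Definition gdim : int := sdim Ind.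

Definition bipartite : Prop :=
  exists V1 V2 : {set V},
    [/\ V1 :&: V2 = set0, V1 :|: V2 = setT &
        forall u v, e u v ->
          (u \in V1) && (v \in V2) || (u \in V2) && (v \in V1)].

(* A perfect matching of the non-isolated vertices; m v is the partner of v. *)
Definition perfect_matching (m : V -> V) : Prop :=
  forall v, [exists u, e v u] -> e v (m v) /\ m (m v) = v.

(* A complete bipartite subgraph K_{n,n} of G with parts A and B, in the sense
   used for unmixed bipartite graphs: the non-isolated vertices of such a graph
   can be listed as x_1..x_r, y_1..y_r with every x_i y_i an edge, and
   the K_{n,n} considered are those on {x_i, y_i : i in C}. Without this
   matching condition every Ferrers graph x_i y_j (i <= j), which is
   Cohen-Macaulay, would count for r >= 3: it contains the K_{2,2} on
   {x_1, x_2} and {y_2, y_3}. *)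
Definition is_Knn (n : nat) (A B : {set V}) : Prop :=
  [/\ #|A| = n, #|B| = n, (forall a b, a \in A -> b \in B -> e a b) &
      exists2 m, perfect_matching m & [set m a | a in A] = B].

Definition maximal_Knn (n : nat) (A B : {set V}) : Prop :=
  is_Knn n A B /\
  (forall n' A' B', is_Knn n' A' B' ->
     A :|: B \subset A' :|: B' -> A' :|: B' = A :|: B).

(* dim K_{n,n} = n - 1, so comparing dimensions amounts to comparing n. *)
Definition min_maximal_Knn (n : nat) (A B : {set V}) : Prop :=
  [/\ (2 <= n)%N, maximal_Knn n A B &
      forall n' A' B', (2 <= n')%N -> maximal_Knn n' A' B' -> (n <= n')%N].

Definition graph_CM (k : fieldType) : Prop := cohen_macaulay k Ind.

Definition graph_CM_t (k : fieldType) (t : nat) : Prop := CM_t k t Ind.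

End Graphs.

(* Main.v *)
(* List the non-isolated vertices as x_i, y_i = m x_i along a perfect matching.
   Unmixedness makes "i <= j iff x_i ~ y_j" a preorder, and the maximal K_{n,n}
   are its classes. The link of a face F is the independence complex of the
   graph left after deleting F and its neighbours; it is again given by a
   preorder, whose classes are among the old ones. If F has at least d - n + 1
   vertices there is no room left for a class with at least n elements, so the
   preorder is a partial order, and then the x_i - y_i together with the
   isolated vertices are a regular sequence: identifying x_i with y_i gives
   monomial quotients in which every step can be checked on monomials.
   Conversely a suitable face of size d - n has as its link the independence
   complex of K_{n,n}, two disjoint simplices, whose depth is 1 and whose
   dimension is n.
   Krull dimension and depth are both bounded by the size of the largest face
   because chains of primes and regular sequences yield elements of the
   quotient that are algebraically independent over k. *)
Require Import Defs.
From mathcomp Require Import all_boot all_order all_algebra.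
From mathcomp Require Import mpoly zify ring.

Set Implicit Arguments.
Unset Strict Implicit.
Unset Printing Implicit Defensive.

Import GRing.Theory.

(** * Chains of ideals and algebraic independence *)

Section IdealTheory.
Local Open Scope ring_scope.
Variable R : comNzRingType.
Implicit Types (I J : R -> Prop) (s : seq R).

Lemma ideal0 I : is_ideal I -> I 0. Proof. by case. Qed.
Lemma idealD I x y : is_ideal I -> I x -> I y -> I (x + y).
Proof. by case=> _ + _; apply. Qed.
Lemma idealMl I a x : is_ideal I -> I x -> I (a * x).
Proof. by case=> _ _; apply. Qed.
Lemma idealMr I a x : is_ideal I -> I x -> I (x * a).
Proof. by rewrite mulrC; apply: idealMl. Qed.
Lemma idealN I x : is_ideal I -> I x -> I (- x).
Proof. by move=> idI Ix; rewrite -mulN1r; apply: idealMl. Qed.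
Lemma idealB I x y : is_ideal I -> I x -> I y -> I (x - y).
Proof. by move=> idI Ix Iy; apply: idealD => //; apply: idealN. Qed.

Lemma ideal_sum I (T : Type) (r : seq T) (P : pred T) (F : T -> R) :
  is_ideal I -> (forall i, P i -> I (F i)) -> I (\sum_(i <- r | P i) F i).
Proof.
move=> idI IF; elim/big_rec: _ => [|i x Pi Ix]; first exact: ideal0.
by apply: idealD => //; apply: IF.
Qed.

Lemma ideal_gen_ideal (A : R -> Prop) : is_ideal (ideal_gen A).
Proof.
split=> [I idI _|x y Ax Ay I idI AI|a x Ax I idI AI].
- exact: ideal0.
- by apply: idealD => //; [apply: Ax | apply: Ay].
- by apply: idealMl => //; apply: Ax.
Qed.

Lemma ideal_gen_mem (A : R -> Prop) a : A a -> ideal_gen A a.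
Proof. by move=> Aa I _; apply. Qed.

Lemma ideal_add_seq_mem I s x : I x -> ideal_add_seq I s x.
Proof. by move=> Ix; apply: ideal_gen_mem; left. Qed.

Lemma ideal_add_seq_seq I s x : x \in s -> ideal_add_seq I s x.
Proof. by move=> sx; apply: ideal_gen_mem; right. Qed.

Lemma ideal_add_seq_sub I J s x :
  is_ideal J -> (forall y, I y -> J y) -> (forall y, y \in s -> J y) ->
  ideal_add_seq I s x -> J x.
Proof. by move=> idJ IJ sJ; apply=> // a [/IJ|/sJ]. Qed.

Lemma ideal_add_seq_nil I x : is_ideal I -> ideal_add_seq I [::] x -> I x.
Proof. by move=> idI; apply: ideal_add_seq_sub. Qed.

Lemma ideal_add_seq_incl I s s' x :
  {subset s <= s'} -> ideal_add_seq I s x -> ideal_add_seq I s' x.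
Proof.
move=> ss'; apply: ideal_add_seq_sub; first exact: ideal_gen_ideal.
- exact: ideal_add_seq_mem.
- by move=> y /ss'; apply: ideal_add_seq_seq.
Qed.

(** The elements congruent modulo [I] to a multiple of [f] form an ideal containing the
    generators. *)
Lemma ideal_add_seq1 I f x : is_ideal I -> ideal_add_seq I [:: f] x ->
  exists a, I (x - a * f).
Proof.
move=> idI If_x; apply: (If_x (fun x => exists a, I (x - a * f))); last first.
  move=> y [Iy|]; first by exists 0; rewrite mul0r subr0.
  by rewrite inE => /eqP->; exists 1; rewrite mul1r subrr; apply: ideal0.
split=> [|y z [a Ia] [b Ib]|b y [a Ia]].
- by exists 0; rewrite mul0r subr0; apply: ideal0.
- by exists (a + b); rewrite mulrDl opprD addrACA; apply: idealD.
- by exists (b * a); rewrite -mulrA -mulrBr; apply: idealMl.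
Qed.

(* Both chains of primes and regular sequences give rise to such data, which
   is all that is needed to bound their length. *)
Definition nzd_chain (J : nat -> R -> Prop) s : Prop :=
  [/\ forall i, (i <= size s)%N -> is_ideal (J i),
      forall i, (i < size s)%N -> forall x, J i x -> J i.+1 x,
      forall i, (i < size s)%N -> J i.+1 s`_i,
      forall i, (i < size s)%N -> forall g, J i (s`_i * g) -> J i g &
      ~ J (size s) 1].

Lemma nzd_chain_cons (J : nat -> R -> Prop) f s :
  nzd_chain J (f :: s) -> nzd_chain (fun i => J i.+1) s.
Proof.
case=> /= idJ incJ memJ nzJ J1; split=> // i ilt; [exact: (idJ i.+1)|
  exact: (incJ i.+1)|exact: (memJ i.+1)|exact: (nzJ i.+1)].
Qed.

Lemma regular_seq_nzd_chain I s :
  regular_seq I s -> nzd_chain (fun i => ideal_add_seq I (take i s)) s.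
Proof.
case=> reg n1; split=> //.
- by move=> i _; apply: ideal_gen_ideal.
- move=> i ilt x; apply: ideal_add_seq_incl => y.
  by rewrite (take_nth 0 ilt) mem_rcons inE orbC => ->.
- move=> i ilt; apply: ideal_add_seq_seq.
  by rewrite (take_nth 0 ilt) mem_rcons inE eqxx.
- by rewrite take_size.
Qed.

(** An element of [P i.+1] outside [P i] is a nonzerodivisor modulo the prime [P i]; such elements
    form [s]. *)
Lemma prime_chain_nzd_chain I h P : prime_chain I h P ->
  exists2 s, nzd_chain P s & size s = h.
Proof.
case=> prP incP.
have [s ss sP] : exists2 s, size s = h &
    forall i, (i < h)%N -> P i.+1 s`_i /\ ~ P i s`_i.
  have: forall i, (i < h)%N -> exists x, P i.+1 x /\ ~ P i x.
    by move=> i /incP[].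
  elim: h {prP incP} => [|h IH] ex; first by exists [::].
  have [i ilt|s ss sP] := IH; first by apply: ex; lia.
  have [x Px] := ex h (ltnSn h).
  exists (rcons s x) => [|i]; first by rewrite size_rcons ss.
  rewrite nth_rcons ss ltnS leq_eqVlt => /orP[/eqP->|ilt].
    by rewrite ltnn eqxx.
  by rewrite ilt; apply: sP.
exists s => //; split; rewrite ?ss.
- by move=> i /prP[[]].
- by move=> i /incP[].
- by move=> i /sP[].
- move=> i ilt g; have [[_ _ pr] _] := prP i (ltnW ilt).
  by have [_ nPs] := sP i ilt; case/pr.
- by have [[]] := prP h (leqnn h).
Qed.

End IdealTheory.

(** * Algebraic independence along a chain of nonzerodivisors *)

Section Independence.
Local Open Scope ring_scope.
Variables (k : fieldType) (n : nat).
Implicit Types (s : seq {mpoly k[n]}) (c : seq nat -> k).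

(* c lists the coefficients of a polynomial in size s variables with all
   exponents below N; box_eval evaluates it at s. *)
Fixpoint box_eval N s c : {mpoly k[n]} :=
  if s is f :: s' then
    \sum_(i < N) f ^+ i * box_eval N s' (fun a => c (nat_of_ord i :: a))
  else (c [::])%:MP.

Lemma box_eval_ext N s c c' : (forall a, size a = size s ->
  all (fun i => (i < N)%N) a -> c a = c' a) -> box_eval N s c = box_eval N s c'.
Proof.
elim: s c c' => [|f s IH] c c' cc' /=; first by rewrite cc'.
apply: eq_bigr => i _; congr (_ * _); apply: IH => a sa aN.
by apply: cc' => /=; rewrite ?sa ?ltn_ord.
Qed.

Lemma box_eval_linear N s (U : finType) (r : U -> k) (c : U -> seq nat -> k) :
  box_eval N s (fun a => \sum_u r u * c u a) =
  \sum_u r u *: box_eval N s (c u).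
Proof.
elim: s c => [|f s IH] c /=.
  by rewrite raddf_sum; apply: eq_bigr => u _ /=; rewrite mpolyCM mul_mpolyC.
under eq_bigr => i _ do rewrite (IH (fun u a => c u (nat_of_ord i :: a))).
under [RHS]eq_bigr => u _ do rewrite scaler_sumr.
rewrite exchange_big; apply: eq_bigr => i _; rewrite mulr_sumr.
by apply: eq_bigr => u _; rewrite scalerAr.
Qed.

(* If the lowest power of f with a nonzero coefficient is f^i, one can cancel
   f^i and reduce modulo f. *)
Lemma box_eval_indep N s (J : nat -> {mpoly k[n]} -> Prop) c :
  nzd_chain J s -> J 0%N (box_eval N s c) ->
  forall a, size a = size s -> all (fun i => (i < N)%N) a -> c a = 0.
Proof.
elim: s J c => [|f s IH] J c chJ /=.
  case: chJ => /= idJ _ _ _ n1 Jc a /size0nil-> _.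
  have [//|c0] := eqVneq (c [::]) 0; case: n1.
  have := idealMl ((c [::])^-1)%:MP (idJ 0%N (leqnn _)) Jc.
  by rewrite -mpolyCM mulVf.
move=> Jc [//|i a] [sa] /= /andP[iN aN].
have chS := nzd_chain_cons chJ; case: chJ => /= idJ incJ memJ nzJ n1.
have id0 : is_ideal (J 0%N) by apply: idJ.
have id1 : is_ideal (J 1%N) by apply: idJ.
elim/ltn_ind: i => i IHi in iN a sa aN *.
pose E (j : nat) := box_eval N s (fun a => c (j :: a)).
apply: (IH _ (fun a => c (i :: a)) chS) => //.
have cancel_pow e g : J 0%N (f ^+ e * g) -> J 0%N g.
  elim: e => [|e IHe]; first by rewrite mul1r.
  by rewrite exprS -mulrA => /(nzJ 0%N isT).
have E0 j : (j < i)%N -> E j = 0.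
  move=> ji; rewrite /E (box_eval_ext (c' := fun=> 0)) => [|b sb bN].
    elim: (s) => [|g t IHt] /=; first by rewrite mpolyC0.
    by rewrite big1 // => l _; rewrite IHt mulr0.
  by apply: IHi => //; lia.
(* The blocks below [i] vanish by induction, so [f ^+ i] factors out, and all that remains beside
   [E i] is a multiple of [f]. *)
have: J 0%N (f ^+ i * (E i + f * \sum_(j < N | (i < j)%N) f ^+ (j - i.+1) * E j)).
  move: Jc; rewrite -/(E _) (bigID (fun j : 'I_N => (j < i)%N)) /= big1 => [|j ji].
    rewrite add0r (bigD1 (Ordinal iN)) /=; last by rewrite -leqNgt.
    congr (J _ _); rewrite mulrDr; congr (_ + _).
    rewrite mulrA mulr_sumr; apply: eq_big => [j|j ji].
      by rewrite -leqNgt ltn_neqAle eq_sym andbC.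
    rewrite mulrA -exprSr -exprD; congr (_ ^+ _ * _).
    by move: ji; rewrite -val_eqE /=; lia.
  by rewrite -/(E j) E0 ?mulr0.
move/cancel_pow/(incJ 0%N isT) => JE.
rewrite -[box_eval _ _ _](addrK (f * \sum_(j < N | (i < j)%N) f ^+ (j - i.+1) * E j)).
by apply: idealB JE _ => //; apply: idealMr (memJ 0%N isT).
Qed.

Definition deg_le d (p : {mpoly k[n]}) := all (fun m => mdeg m <= d)%N (msupp p).

Lemma deg_leM d e p q : deg_le d p -> deg_le e q -> deg_le (d + e) (p * q).
Proof.
move=> /allP dp /allP dq; apply/allP => m /msuppM_le /allpairsP[[m1 m2] /= []].
by move=> /dp ? /dq ? ->; rewrite mdegD leq_add.
Qed.

Lemma deg_le_sum d (T : Type) (r : seq T) (F : T -> {mpoly k[n]}) :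
  (forall i, deg_le d (F i)) -> deg_le d (\sum_(i <- r) F i).
Proof.
move=> dF; elim/big_rec: _ => [|i p _ dp]; first by rewrite /deg_le msupp0.
apply/allP => m /msuppD_le; rewrite mem_cat => /orP[] mp; first exact: (allP (dF i)).
exact: (allP dp).
Qed.

Lemma deg_leW d e p : (d <= e)%N -> deg_le d p -> deg_le e p.
Proof. by move=> de /allP dp; apply/allP => m /dp /leq_trans->. Qed.

Lemma deg_leC d a : deg_le d a%:MP.
Proof. by rewrite /deg_le msuppC; case: eqP => //= _; rewrite mdeg0. Qed.

Lemma deg_leX d e p : deg_le d p -> deg_le (e * d) (p ^+ e).
Proof.
move=> dp; elim: e => [|e IH]; first by rewrite expr0 -mpolyC1 deg_leC.
by rewrite exprS mulSn deg_leM.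
Qed.

(** A crude bound: exponents are below [N] and [msize f] bounds the degree of [f]. Only linear
    growth in [N] matters for counting monomials. *)
Lemma deg_le_box_eval N s c :
  deg_le (N * sumn [seq msize f | f <- s]) (box_eval N s c).
Proof.
elim: s c => [|f s IH] c /=; first by rewrite deg_leC.
apply: deg_le_sum => i; rewrite mulnDr; apply: deg_leM => //.
apply: (@deg_leW (i * msize f)); first by rewrite leq_mul2r ltnW ?orbT.
by apply: deg_leX; apply/allP => m /msize_mdeg_lt/ltnW.
Qed.

End Independence.

(** * Stanley-Reisner rings *)

Section StanleyReisner.
Local Open Scope ring_scope.
Variables (k : fieldType) (T : finType).
Implicit Types (D : {set {set T}}) (F : {set T}) (m : 'X_{1..#|T|}).
Local Notation SR := (@stanley_reisner_ideal T k).

Definition mvar (v : T) : {mpoly k[#|T|]} := 'X_(enum_rank v).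

Definition msupport m : {set T} := [set v | m (enum_rank v) != 0%N].

Definition mface F : 'X_{1..#|T|} := [multinom (enum_val i \in F : nat) | i < #|T|].

Lemma mfaceE F v : mface F (enum_rank v) = (v \in F).
Proof. by rewrite mnmE enum_rankK. Qed.

Lemma mface_le F m : (mface F <= m)%MM = (F \subset msupport m).
Proof.
apply/mnm_lepP/subsetP => [le v vF|sub i].
  by have := le (enum_rank v); rewrite mfaceE vF inE lt0n.
rewrite -[i]enum_valK mfaceE; case: (boolP (_ \in F)) => // /sub.
by rewrite inE -lt0n.
Qed.

Lemma face_monomialE F : face_monomial k F = 'X_[mface F].
Proof.
rewrite mpolyXE_id /face_monomial.
rewrite (reindex (fun v : T => enum_rank v)) /=; last first.
  by exists enum_val => ? _; rewrite ?enum_rankK ?enum_valK.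
rewrite [RHS](bigID (fun v => v \in F)) /= [X in _ * X]big1 => [|v /negPf vF].
  by rewrite mulr1; apply: eq_bigr => v vF; rewrite mfaceE vF expr1.
by rewrite mfaceE vF expr0.
Qed.

Lemma SR_ideal D : is_ideal (SR D). Proof. exact: ideal_gen_ideal. Qed.

(** The monomial is a multiple of the face monomial of its support. *)
Lemma SR_mpolyX D m : msupport m \notin D -> SR D 'X_[m].
Proof.
move=> Dm; rewrite -(@submK _ (mface (msupport m)) m) ?mface_le // mpolyXD.
apply: (idealMl _ (SR_ideal D)).
by apply: ideal_gen_mem; exists (msupport m); rewrite ?face_monomialE.
Qed.

Lemma ideal_mpoly (I : {mpoly k[#|T|]} -> Prop) p : is_ideal I ->
  (forall m, m \in msupp p -> I 'X_[m]) -> I p.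
Proof.
move=> idI Ip; rewrite [p]mpolyE big_seq; apply: ideal_sum => // m /Ip Im.
by rewrite -mul_mpolyC; apply: idealMl.
Qed.

Lemma SR_mpoly D p : (forall m, m \in msupp p -> msupport m \notin D) -> SR D p.
Proof.
by move=> Dp; apply: ideal_mpoly (SR_ideal D) _ => m /Dp; apply: SR_mpolyX.
Qed.

(* Modulo the Stanley-Reisner ideal, the polynomials of degree at most M span
   a space of dimension O(M ^ d): there are too few of them for the N ^ size s
   monomials in s with exponents below N to be independent. *)
Lemma box_eval_dependent D d s : (forall F, F \in D -> (#|F| <= d)%N) ->
  (d < size s)%N -> exists N c,
    SR D (box_eval N s c) /\
    exists2 a, size a = size s /\ all (fun i => (i < N)%N) a & c a != 0.
Proof.
move=> Dd ds.
pose e := (sumn [seq msize f | f <- s]).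
(* [N] is chosen so that [N ^ d.+1] exceeds the number of pairs in [K] below; [M] bounds the degree
   of every [box_eval N s c]. *)
pose N := (2 ^ #|T| * e.+1 ^ d).+1; pose M := (N * e)%N.
pose U := ((size s).-tuple 'I_N : finType).
(* A pair encodes a monomial by its support and its exponents along the enumeration of the support.
   All supports of size at most [d] with exponents at most [M] are reached. *)
pose K := ({set T} * d.-tuple 'I_M.+1 : finType)%type.
pose mk (x : K) := [multinom
  if enum_val i \in x.1 then
    nth 0%N [seq val j | j <- x.2] (index (enum_val i) (enum x.1))
  else 0%N | i < #|T|].
pose expo (u : U) : seq nat := [seq val j | j <- u].
pose cu (u : U) (a : seq nat) : k := (a == expo u)%:R.
(* Each row holds the coefficients of one monomial in [s]. There are more rows than columns, and a
   left kernel vector gives a combination without monomials supported on faces. *)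
pose A := \matrix_(i < #|U|, j < #|K|)
  (box_eval N s (cu (enum_val i)))@_(mk (enum_val j)).
have ltKU : (#|K| < #|U|)%N.
  rewrite card_prod !card_tuple !card_ord -(cardsT {set T}) -powersetT.
  rewrite card_powerset cardsT.
  have N0 : (0 < N)%N by [].
  apply: (@leq_trans (N ^ d.+1)%N); last by rewrite leq_pexp2l.
  apply: (@leq_ltn_trans (2 ^ #|T| * (N * e.+1) ^ d)%N).
    rewrite leq_mul2l; apply/orP; right.
    have le_MN : (M.+1 <= N * e.+1)%N by rewrite /M; nia.
    by case: (d) => // d'; rewrite leq_exp2r.
  by rewrite expnMn mulnCA mulnC expnS ltn_pmul2r ?expn_gt0 // ltnS.
have /rowV0Pn[r /sub_kermxP rA r0] : kermx A != 0.
  rewrite kermx_eq0 /row_free; have := rank_leq_col A; lia.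
pose c (a : seq nat) : k := \sum_u r 0 (enum_rank u) * cu u a.
have cE u : c (expo u) = r 0 (enum_rank u).
  rewrite /c (bigD1 u) //= /cu eqxx mulr1 big1 ?addr0 // => v vu.
  rewrite (inj_eq _) ?[u == v]eq_sym ?(negPf vu) ?mulr0 // => x y /inj_map xy.
  by apply/val_inj/xy/val_inj.
exists N, c; split; last first.
  have /rV0Pn[j rj] := r0; exists (expo (enum_val j)); last by rewrite cE enum_valK.
  by rewrite size_map size_tuple; split=> //; apply/allP => i /mapP[l _ ->] /=.
apply: SR_mpoly => m mc; apply/negP => mD.
have [x mkx] : exists x, mk x = m.
  pose l := [seq m (enum_rank v) | v <- enum (msupport m)].
  have sl : (size l <= d)%N by rewrite size_map -cardE Dd.
  exists (msupport m, [tuple inord (nth 0%N l j) | j < d]); apply/mnmP => i.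
  rewrite mnmE /=; case: ifPn => [iF|]; last first.
    by rewrite inE enum_valK negbK => /eqP.
  have il : (index (enum_val i) (enum (msupport m)) < size l)%N.
    by rewrite size_map index_mem mem_enum.
  have id : (index (enum_val i) (enum (msupport m)) < d)%N by apply: leq_trans sl.
  rewrite (nth_map ord0) ?size_tuple ?card_ord // (nth_map (Ordinal id)) ?size_enum_ord //.
  rewrite -[X in nth _ (enum _) X]/(nat_of_ord (Ordinal id)) nth_ord_enum /= inordK.
    rewrite (nth_map (enum_val i)); last by rewrite -(size_map (fun v => m (enum_rank v))).
    by rewrite nth_index ?mem_enum // enum_valK.
  have /allP/(_ m mc) := deg_le_box_eval N s c; rewrite ltnS => /(leq_trans _); apply.
  rewrite mdegE (nth_map (enum_val i)); last by rewrite -(size_map (fun v => m (enum_rank v))).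
  by rewrite nth_index ?mem_enum // enum_valK (bigD1 i) //= leq_addr.
move: mc; rewrite mcoeff_msupp box_eval_linear raddf_sum /= => /eqP; apply.
have /rowP/(_ (enum_rank x)) := rA; rewrite !mxE => rAx.
rewrite -[RHS]rAx [LHS](reindex (fun i : 'I_#|U| => enum_val i : U)) /=; last first.
  by exists enum_rank => ? _; rewrite ?enum_rankK ?enum_valK.
by apply: eq_bigr => i _; rewrite mcoeffZ mxE enum_rankK enum_valK mkx.
Qed.

End StanleyReisner.

(** * Bounds on Krull dimension and depth, and a criterion for Cohen-Macaulayness *)

Section Criterion.
Local Open Scope ring_scope.
Variables (k : fieldType) (T : finType).
Implicit Types (D : {set {set T}}) (F S : {set T}) (m : 'X_{1..#|T|}).
Implicit Types (I : {mpoly k[#|T|]} -> Prop) (h : T -> {mpoly k[#|T|]}).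
Local Notation SR := (@stanley_reisner_ideal T k).
Local Notation X := (@mvar k T).
Local Notation tsubst h := (comp_mpoly [tuple h (enum_val i) | i < #|T|]).

(** More than [d] elements would satisfy a nontrivial relation modulo [SR D], which [box_eval_indep]
    forbids. *)
Lemma nzd_chain_size D d J s : (forall F, F \in D -> (#|F| <= d)%N) ->
  nzd_chain J s -> (forall p, SR D p -> J 0%N p) -> (size s <= d)%N.
Proof.
move=> Dd chJ DJ; rewrite leqNgt; apply/negP => ds.
have [N [c [/DJ Jc [a [sa aN] /eqP[]]]]] := box_eval_dependent Dd ds.
exact: box_eval_indep chJ Jc a sa aN.
Qed.

Lemma tsubst_var h v : tsubst h (X v) = h v.
Proof.
by rewrite /mvar comp_mpolyXU -tnth_nth tnth_mktuple enum_rankK.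
Qed.

Lemma tsubst_face h F : tsubst h (face_monomial k F) = \prod_(v in F) h v.
Proof. by rewrite rmorph_prod; apply: eq_bigr => v _; apply: tsubst_var. Qed.

Lemma tsubst_congr I h p : is_ideal I -> (forall v, I (X v - h v)) ->
  I (p - tsubst h p).
Proof.
move=> idI Ih; elim/mpolyind: p => [|c m p _ _ IHp].
  by rewrite comp_mpoly0 subr0; apply: ideal0.
rewrite comp_mpolyD comp_mpolyZ opprD addrACA -scalerBr.
apply: idealD => //; rewrite -mul_mpolyC; apply: (idealMl _ idI).
have IM a b a' b' : I (a - b) -> I (a' - b') -> I (a * a' - b * b').
  move=> Ia Ib; have -> : a * a' - b * b' = a' * (a - b) + b * (a' - b') by ring.
  by apply: idealD => //; apply: idealMl.
have I1 : I (1 - 1) by rewrite subrr; apply: ideal0.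
rewrite comp_mpolyX mpolyXE_id.
apply: (big_ind2 (fun a b => I (a - b))) => // i _; elim: (m i) => [|e IHe]; first by rewrite !expr0.
rewrite !exprS; apply: IM => //.
by rewrite tnth_mktuple -{1}[i]enum_valK; apply: Ih.
Qed.

(** The kernel of [restr S] is the ideal generated by the variables in [S]; as the kernel of a map
    into a domain it is prime. *)
Definition kill S v : {mpoly k[#|T|]} := if v \in S then 0 else X v.
Local Notation restr S := (tsubst (kill S)).

Lemma restr_ideal S : is_ideal (fun p => restr S p = 0).
Proof.
split=> [|x y x0 y0|a x x0]; first exact: comp_mpoly0.
- by rewrite comp_mpolyD x0 y0 addr0.
- by rewrite rmorphM /= x0 mulr0.
Qed.

Lemma restr_restr S S' p : S \subset S' -> restr S' (restr S p) = restr S' p.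
Proof.
move=> SS'; apply/esym/eqP; rewrite -subr_eq0 -comp_mpolyB; apply/eqP.
apply: (tsubst_congr _ (restr_ideal S')) => v.
rewrite comp_mpolyB tsubst_var [kill S v]/kill; case: ifP => vS.
  by rewrite /kill (subsetP SS' v vS) comp_mpoly0 subr0.
by rewrite tsubst_var subrr.
Qed.

(** A nonface is not contained in the complement of [S], so its monomial has a killed variable. *)
Lemma restr_SR D S p : (forall F, F \subset ~: S -> F \in D) -> SR D p ->
  restr S p = 0.
Proof.
move=> SD Dp; apply: (Dp _ (restr_ideal S)) => _ [F FD ->].
rewrite tsubst_face; have [v vF vS] : exists2 v, v \in F & v \in S.
  have /subsetPn[v vF] := contraNN (SD F) FD.
  by rewrite inE negbK; exists v.
by rewrite (bigD1 v) //= /kill vS mul0r.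
Qed.

Lemma mvar_neq0 v : X v != 0.
Proof. by rewrite -msize_poly_eq0 msizeX. Qed.

Lemma restr_prime S : prime_ideal (fun p => restr S p = 0).
Proof.
split=> [||x y]; first exact: restr_ideal.
  by move/eqP; rewrite comp_mpoly1 oner_eq0.
by rewrite rmorphM /= => /eqP; rewrite mulf_eq0 => /orP[]/eqP; [left|right].
Qed.

(** The vertices outside [F] are killed first, then those of [F] one at a time; the variable newly
    killed makes each inclusion strict. *)
Lemma face_prime_chain D F : (forall F', F' \subset F -> F' \in D) ->
  exists P, prime_chain (SR D) #|F| P.
Proof.
move=> FD; pose S i := ~: F :|: [set v in take i (enum F)].
exists (fun i p => restr (S i) p = 0); split=> i iF.
  split=> [|p]; first exact: restr_prime.
  apply: restr_SR => F' /subset_trans sF'; apply/FD/sF'.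
  by rewrite setCU setCK subsetIl.
have /card_gt0P[v0 _] : (0 < #|F|)%N by apply: leq_ltn_trans iF.
have sz : (i < size (enum F))%N by rewrite -cardE.
have SS : S i \subset S i.+1.
  apply/setUS/subsetP => v; rewrite !inE (take_nth v0 sz) mem_rcons inE => ->.
  by rewrite orbT.
split=> [p p0|]; first by rewrite -(restr_restr _ SS) p0 comp_mpoly0.
pose v := nth v0 (enum F) i; have vF : v \in F by rewrite -mem_enum mem_nth.
exists (X v); rewrite !tsubst_var /kill !inE vF /= (take_nth v0 sz) mem_rcons.
rewrite inE eqxx; split=> //; rewrite ifN; first exact/eqP/mvar_neq0.
have := enum_uniq F; rewrite -{1}(cat_take_drop i (enum F)) cat_uniq.
case/and3P=> _ /hasPn/(_ v) + _; apply; rewrite (drop_nth v0 sz) inE.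
by rewrite eqxx.
Qed.

(** [F] supplies a chain of primes and [s] a regular sequence, both of length [#|F|]; by
    [nzd_chain_size] neither kind can be longer. *)
Lemma CM_criterion D F s : (forall F', F' \in D -> (#|F'| <= #|F|)%N) ->
  (forall F', F' \subset F -> F' \in D) ->
  homog_regular_seq (SR D) s -> size s = #|F| -> cohen_macaulay k D.
Proof.
move=> DF FD regs ss; exists #|F|; split; split.
- exact: face_prime_chain.
- move=> n P chP; have [t cht <-] := prime_chain_nzd_chain chP.
  by apply: nzd_chain_size DF cht _ => p; case: chP => /(_ 0%N isT)[_ IP] _; apply: IP.
- by exists s.
- move=> t [regt _]; apply: nzd_chain_size DF (regular_seq_nzd_chain regt) _.
  by move=> p; apply: ideal_add_seq_mem.
Qed.

End Criterion.

Local Notation tsubst h := (comp_mpoly [tuple h (enum_val i) | i < #|_|]).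
Local Notation restr k S := (tsubst (kill k S)).

(** * The union of two disjoint simplices *)

Section TwoSimplices.
Local Open Scope ring_scope.
Variables (k : fieldType) (T : finType).
Implicit Types (D : {set {set T}}) (A B : {set T}) (f : {mpoly k[#|T|]}).
Local Notation SR := (@stanley_reisner_ideal T k).
Local Notation X := (@mvar k T).

Definition is_two_simplices D A B : Prop :=
  [disjoint A & B] /\ forall F, (F \in D) = (F \subset A) || (F \subset B).

Lemma is_two_simplicesC D A B : is_two_simplices D A B -> is_two_simplices D B A.
Proof. by case=> AB DE; split=> [|F]; rewrite 1?disjoint_sym // DE orbC. Qed.

Lemma restr_mpolyX A m : restr k (~: A) 'X_[m] =
  if msupport m \subset A then 'X_[m] else 0.
Proof.
rewrite comp_mpolyX; case: ifPn => [/subsetP mA|/subsetPn[v]].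
  rewrite mpolyXE_id; apply: eq_bigr => i _; rewrite tnth_mktuple /kill inE.
  case: (boolP (_ \in A)) => /= [_|iA]; first by rewrite /mvar enum_valK.
  have := contra (mA (enum_val i)) iA; rewrite inE enum_valK negbK => /eqP->.
  by rewrite !expr0.
rewrite inE => mv vA; rewrite (bigD1 (enum_rank v)) //= tnth_mktuple enum_rankK.
by rewrite /kill inE vA /= expr0n (negPf mv) mul0r.
Qed.

Lemma restr_sum A f :
  restr k A f = \sum_(m <- msupp f) f@_m *: restr k A 'X_[m].
Proof.
rewrite {1}[f]mpolyE raddf_sum; apply: eq_bigr => m _; exact: comp_mpolyZ.
Qed.

(** Each monomial of the restriction involves a vertex of [A], which is outside [B]; multiplied by
    [X v] it also involves a vertex outside [A], so its support is no face. *)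
Lemma mvar_restr_SR D A B f v : is_two_simplices D A B -> 0%MM \notin msupp f ->
  v \notin A -> SR D (X v * restr k (~: A) f).
Proof.
move=> [AB DE] f0 vA; rewrite restr_sum mulr_sumr big_seq.
apply: ideal_sum (SR_ideal _ _) _ => m mf; rewrite restr_mpolyX.
case: ifPn => [mA|_]; last by rewrite scaler0 mulr0; apply: ideal0 (SR_ideal _ _).
rewrite -scalerAr -mul_mpolyC; apply: (idealMl _ (SR_ideal k D)).
rewrite /mvar -mpolyXD; apply: SR_mpolyX; rewrite DE negb_or.
have vS : v \in msupport (U_(enum_rank v) + m)%MM.
  by rewrite inE mnmDE mnm1E eqxx.
apply/andP; split; apply/subsetPn; first by exists v.
have [w wm] : exists w, w \in msupport m.
  apply/set0Pn; apply: contraNneq f0 => m0; rewrite (_ : 0%MM = m) //.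
  apply/mnmP => i; rewrite mnm0E; apply/esym/eqP; rewrite -[_ == _]negbK.
  by have /setP/(_ (enum_val i)) := m0; rewrite !inE enum_valK => ->.
exists w; last by rewrite (disjointFr AB) // (subsetP mA).
by move: wm; rewrite !inE mnmDE; case: (m _) => // e _; rewrite addnS.
Qed.

(** A nonconstant monomial is supported on [A] alone, on [B] alone, or on a nonface. *)
Lemma two_simplices_decomp D A B f : is_two_simplices D A B ->
  0%MM \notin msupp f ->
  SR D (f - restr k (~: A) f - restr k (~: B) f).
Proof.
move=> [AB DE] f0; rewrite {1}[f]mpolyE !restr_sum -!sumrB big_seq.
apply: ideal_sum (SR_ideal _ _) _ => m mf; rewrite -!scalerBr.
rewrite -mul_mpolyC; apply: (idealMl _ (SR_ideal k D)); rewrite !restr_mpolyX.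
case: ifPn => mA; last first.
  rewrite subr0; case: ifPn => mB; last by rewrite subr0; apply: SR_mpolyX; rewrite DE negb_or mA.
  by rewrite subrr; apply: ideal0 (SR_ideal _ _).
rewrite subrr ifN ?subr0; first exact: ideal0 (SR_ideal _ _).
apply: contraNN f0 => mB; rewrite (_ : 0%MM = m) //.
apply/mnmP => i; rewrite mnm0E; apply/esym/eqP; rewrite -[_ == _]negbK.
apply/negP => mi; have iS : enum_val i \in msupport m by rewrite inE enum_valK.
by have := subsetP mB _ iS; rewrite (disjointFr AB) // (subsetP mA).
Qed.

(* With f = g + h modulo the ideal, g on A and h on B, the class of g is a
   nonzero element of the quotient by f that is killed by every variable. *)
Lemma two_simplices_not_CM D A B : is_two_simplices D A B ->
  (2 <= #|A|)%N -> (0 < #|B|)%N -> ~ cohen_macaulay k D.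
Proof.
move=> DAB A2 B1 [d [[_ dimD] [[s [[regs _] homs] ss] _]]].
have DBA := is_two_simplicesC DAB; have [AB DE] := DAB.
have SRi := SR_ideal k D.
have d2 : (2 <= d)%N.
  apply: leq_trans A2 _; have [|P /dimD//] := @face_prime_chain k T D A.
  by move=> F FA; rewrite DE FA.
case: s ss regs homs => [|f1 [|f2 s]] /= ss regs homs; try by lia.
have nc f : f \in [:: f1, f2 & s] -> 0%MM \notin msupp f.
  move=> /homs[c c0 /dhomogP fc]; apply/negP => /fc; rewrite mf0 => c0'.
  by rewrite -c0' in c0.
have nc1 : 0%MM \notin msupp f1 by apply: nc; rewrite inE eqxx.
have nc2 : 0%MM \notin msupp f2 by apply: nc; rewrite !inE eqxx orbT.
have restrA p : SR D p -> restr k (~: A) p = 0.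
  by apply: restr_SR => F; rewrite setCK DE => ->.
have restrB p : SR D p -> restr k (~: B) p = 0.
  by apply: restr_SR => F; rewrite setCK DE orbC => ->.
(* If [X v] killed [f1], regularity would put [X v] itself in the ideal, although [v] is a
   vertex. *)
have reg1 v : v \in A :|: B -> ~ SR D (X v * f1).
  move=> vAB SRv; have /ideal_add_seq_nil : ideal_add_seq (SR D) [::] (X v).
    by apply: (regs 0%N isT); rewrite mulrC; apply: ideal_add_seq_mem.
  move=> /(_ SRi) Xv; have := restrA _ Xv; have := restrB _ Xv.
  rewrite !tsubst_var /kill !inE; case/setUP: vAB => ->.
    by move=> _ /eqP; rewrite (negPf (mvar_neq0 _ _)).
  by move=> /eqP; rewrite (negPf (mvar_neq0 _ _)).
have dec := two_simplices_decomp DAB nc1.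
set g := restr k (~: A) f1 in dec *; set h := restr k (~: B) f1 in dec *.
have g0 : g != 0.
  have /card_gt0P[v vA] : (0 < #|A|)%N by lia.
  apply/eqP => g0; apply: (reg1 v); rewrite ?inE ?vA //.
  have := idealD SRi (idealMl (X v) SRi dec)
    (mvar_restr_SR DBA nc1 (negbT (disjointFr AB vA))).
  by rewrite -/h g0 -mulrDr subr0 subrK.
have h0 : h != 0.
  have /card_gt0P[v vB] := B1.
  apply/eqP => h0; apply: (reg1 v); rewrite ?inE ?vB ?orbT //.
  have := idealD SRi (idealMl (X v) SRi dec)
    (mvar_restr_SR DAB nc1 (negbT (disjointFl AB vB))).
  by rewrite -/g h0 -mulrDr subr0 subrK.
(* [f2] has no constant term, and modulo [f1] every variable kills [g]: those outside [A] directly,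
   those of [A] because [g] is congruent to [- h]. *)
have f2g : ideal_add_seq (SR D) [:: f1] (f2 * g).
  have idf : is_ideal (ideal_add_seq (SR D) [:: f1]) by apply: ideal_gen_ideal.
  rewrite [f2]mpolyE mulr_suml big_seq; apply: (ideal_sum _ idf) => m mf2.
  rewrite -scalerAl -mul_mpolyC; apply: (idealMl _ idf).
  have [w wm] : exists w, m (enum_rank w) != 0%N.
    apply/existsP; apply: contraNT nc2 => /existsPn m0; rewrite (_ : 0%MM = m) //.
    apply/mnmP => i; rewrite mnm0E -[i]enum_valK; apply/esym/eqP.
    by rewrite -[_ == _]negbK.
  rewrite -(@submK _ U_(enum_rank w) m) ?lep1mP // mpolyXD -mulrA.
  apply: (idealMl _ idf); rewrite -/(mvar k w).
  have [wA|wA] := boolP (w \in A); last first.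
    by apply: ideal_add_seq_mem; apply: mvar_restr_SR DAB nc1 wA.
  rewrite -[g](subKr f1) -[f1 - g](subrK h) mulrBr mulrDr; apply: (idealB idf).
    by apply: (idealMl _ idf); apply: ideal_add_seq_seq; rewrite mem_head.
  apply: ideal_add_seq_mem; apply: (idealD SRi); first exact: (idealMl _ SRi dec).
  by apply: (mvar_restr_SR DBA nc1); rewrite (disjointFr AB wA).
(* Regularity of [f2] gives [g = a * f1] modulo the ideal. Then [a] restricts to 1 on [A] and to 0
   on [B], but both restrictions have the constant term of [a]. *)
have /(ideal_add_seq1 SRi)[a ga] := regs 1%N isT g f2g.
have gag : g = restr k (~: A) a * g.
  have gg : restr k (~: A) g = g by rewrite /g restr_restr.
  by have /eqP := restrA _ ga; rewrite comp_mpolyB rmorphM /= gg subr_eq0 => /eqP.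
have hg : restr k (~: B) g = 0.
  have hh : restr k (~: B) h = h by rewrite /h restr_restr.
  have := restrB _ dec; rewrite !comp_mpolyB hh -/h addrAC subrr sub0r => /eqP.
  by rewrite oppr_eq0 => /eqP.
have ha : restr k (~: B) a * h = 0.
  by have /eqP := restrB _ ga; rewrite comp_mpolyB hg sub0r oppr_eq0 rmorphM => /eqP.
have a1 : restr k (~: A) a = 1.
  by apply: (mulIf g0); rewrite mul1r -gag.
have a0 : restr k (~: B) a = 0.
  by apply/eqP; move/eqP: ha; rewrite mulf_eq0 (negPf h0) orbF.
have := restr_restr a (subsetT (~: A)); rewrite a1 comp_mpoly1.
have := restr_restr a (subsetT (~: B)); rewrite a0 comp_mpoly0 => <- /eqP.
by rewrite oner_eq0.
Qed.

End TwoSimplices.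

(** * Independence complexes coming from a partial order *)

Section VariableDifference.
Local Open Scope ring_scope.
Variables (k : fieldType) (n : nat) (bad : pred 'X_{1..n}).
Implicit Types (M : 'X_{1..n}) (g : {mpoly k[n]}) (i j : 'I_n).
Hypothesis badD : forall M M', bad M -> bad (M + M')%MM.

Lemma mcoeffXM i g M :
  ('X_i * g)@_M = if M i == 0%N then 0 else g@_(M - U_(i))%MM.
Proof.
rewrite mulrC; case: ifPn => Mi; last first.
  have le : (U_(i) <= M)%MM by rewrite lep1mP.
  by rewrite -{1}(submK le) addmC mcoeffMX.
apply/eqP; rewrite mcoeff_eq0 (perm_mem (msuppMX _ _)).
by apply/mapP => -[M' _ eM]; move: Mi; rewrite eM mnmDE mnm1E eqxx.
Qed.

Lemma mpolyXU_nzd i g : (forall M, bad (M + U_(i))%MM -> bad M) ->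
  {subset msupp ('X_i * g) <= bad} -> {subset msupp g <= bad}.
Proof.
move=> sq badg M Mg; apply/sq/badg; rewrite mcoeff_msupp mcoeffXM.
by rewrite mnmDE mnm1E eqxx addn1 /= addmK -mcoeff_msupp.
Qed.

(** At [M + U_(i)] the product has the coefficient of [g] at [M] minus that at
    [M' = M + U_(i) - U_(j)]. If the latter is absent, [M + U_(i)] is bad by assumption. Otherwise
    induction applies to [M'], whose exponent at [i] is larger yet below [msize g], and
    squarefreeness in [i] makes [M'] bad. *)
Lemma mpolyXUB_bad i j g : i != j ->
  (forall M, bad (M + U_(i) + U_(i))%MM -> bad (M + U_(i))%MM) ->
  {subset msupp (('X_i - 'X_j) * g) <= bad} ->
  forall M, M \in msupp g -> bad (M + U_(i))%MM.
Proof.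
move=> ij sqi badg M; have [e] := ubnP (msize g - M i)%N.
elim: e M => // e IHe M /ltnSE le Mg.
have [M'g|M'g] := boolP ((M j != 0%N) && ((M + U_(i) - U_(j))%MM \in msupp g)).
  case/andP: M'g => Mj; set M' := (M + U_(i) - U_(j))%MM => M'g.
  have M'i : M' i = (M i).+1.
    by rewrite mnmBE mnmDE !mnm1E eqxx eq_sym (negPf ij) subn0 addn1.
  have ltM' : (M' i < msize g)%N.
    apply: leq_ltn_trans (msize_mdeg_lt M'g).
    by rewrite mdegE (bigD1 i) //= leq_addr.
  have le' : (U_(i) <= M')%MM by rewrite lep1mP M'i.
  have leM : (U_(j) <= M + U_(i))%MM by rewrite lep1mP mnmDE addn_eq0 negb_and Mj.
  rewrite -(submK leM) -/M'; apply: badD.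
  rewrite -(submK le'); apply: sqi; rewrite submK //; apply: IHe => //.
  by move: le ltM'; rewrite M'i; lia.
apply: badg; rewrite mcoeff_msupp mulrBl mcoeffB !mcoeffXM.
rewrite mnmDE mnm1E eqxx addn1 /= addmK !mnmDE mnm1E (negPf ij) addn0.
suff -> : (if M j == 0%N then 0 else g@_(M + U_(i) - U_(j))%MM) = 0.
  by rewrite subr0 -mcoeff_msupp.
case: ifPn M'g => //= _; rewrite mcoeff_msupp negbK => /eqP //.
Qed.

(** The joint hypothesis on [i] and [j] means that no associated prime of the monomial ideal
    contains both variables. *)
Lemma mpolyXUB_nzd i j g : i != j ->
  (forall M, bad (M + U_(i) + U_(i))%MM -> bad (M + U_(i))%MM) ->
  (forall M, bad (M + U_(j) + U_(j))%MM -> bad (M + U_(j))%MM) ->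
  (forall M, bad (M + U_(i))%MM -> bad (M + U_(j))%MM -> bad M) ->
  {subset msupp (('X_i - 'X_j) * g) <= bad} -> {subset msupp g <= bad}.
Proof.
move=> ij sqi sqj both badg M Mg; apply: both.
  exact: mpolyXUB_bad badg _ Mg.
apply: (@mpolyXUB_bad j i g) Mg => //; first by rewrite eq_sym.
move=> N; rewrite -opprB mulNr (perm_mem (msuppN _)); exact: badg.
Qed.

End VariableDifference.

(** * A regular sequence for the independence complex of a partial order *)

Section PosetComplex.
Local Open Scope ring_scope.
Variables (k : fieldType) (T : finType) (e : rel T) (D : {set {set T}}).
Variables (W X : {set T}) (m : T -> T).
Hypothesis e_sym : ssrbool.symmetric e.
Hypothesis e_irr : irreflexive e.
Hypothesis DE : forall F : {set T},
  (F \in D) = (F \subset W) && [forall u in F, forall v in F, ~~ e u v].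
Hypothesis mK : involutive m.
Hypothesis XW : {subset X <= W}.
Hypothesis mXW : forall x, x \in X -> m x \in W.
Hypothesis mX : forall x, x \in X -> m x \notin X.
Hypothesis edgeW : forall u v, u \in W -> v \in W -> e u v ->
  (u \in X) && (m v \in X) || (v \in X) && (m u \in X).
Hypothesis le_refl : forall x, x \in X -> e x (m x).
Hypothesis le_trans : forall x y z, x \in X -> y \in X -> z \in X ->
  e x (m y) -> e y (m z) -> e x (m z).
Hypothesis le_anti : forall x y, x \in X -> y \in X ->
  e x (m y) -> e y (m x) -> x = y.

Local Notation SR := (@stanley_reisner_ideal T k).
Local Notation V := (@mvar k T).
Local Notation U v := (U_(enum_rank v))%MM.
Implicit Types (t : seq T) (M : 'X_{1..#|T|}).

(** [X] with the isolated vertices of [W]: a face of maximal size, which also indexes the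
    parameters. *)
Let F : {set T} := X :|: [set v in W | (v \notin X) && (m v \notin X)].

Definition param v : {mpoly k[#|T|]} := if v \in X then V v - V (m v) else V v.

(* Modulo the parameters indexed by t, the quotient is a monomial one, in
   which m x is replaced by x for each x in t. *)
Definition fold_var t v := if (m v \in X) && (m v \in t) then m v else v.

Definition fold_mvar t v : {mpoly k[#|T|]} := V (fold_var t v).

(** Exponents of the ideal left after folding, generated by the variables off [W], the isolated
    vertices in [t] and the folded edges. For [x] in [t] the edge from [x] to [m x] folds to a
    square. *)
Definition bad t M : bool :=
  [|| [exists v, (v \notin W) && (M (enum_rank v) != 0%N)],
      [exists v, [&& v \in t, v \notin X & M (enum_rank v) != 0%N]] |
      [exists x in X, exists y in X, e x (m y) &&
        (U x + U (fold_var t (m y)) <= M)%MM]].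

Definition folded_bad t (p : {mpoly k[#|T|]}) : Prop :=
  {subset msupp (tsubst (fold_mvar t) p) <= bad t}.

Lemma badP t M : reflect
  [\/ exists2 v, v \notin W & M (enum_rank v) != 0%N,
      exists v, [/\ v \in t, v \notin X & M (enum_rank v) != 0%N] |
      exists x y, [/\ x \in X, y \in X, e x (m y) &
        (U x + U (fold_var t (m y)) <= M)%MM]] (bad t M).
Proof.
apply: (iffP or3P) => -[].
- by case/existsP=> v /andP[vW Mv]; constructor 1; exists v.
- by case/existsP=> v /and3P[vt vX Mv]; constructor 2; exists v.
- case/existsP=> x /andP[xX /existsP[y /and3P[yX exy le]]].
  by constructor 3; exists x, y.
- by case=> v vW Mv; constructor 1; apply/existsP; exists v; rewrite vW.
- by case=> v [vt vX Mv]; constructor 2; apply/existsP; exists v; rewrite vt vX.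
- case=> x [y [xX yX exy le]]; constructor 3; apply/existsP; exists x.
  by rewrite xX; apply/existsP; exists y; rewrite yX exy.
Qed.

Lemma badD t M M' : bad t M -> bad t (M + M')%MM.
Proof.
case/badP=> [[v vW Mv]|[v [vt vX Mv]]|[x [y [xX yX exy le]]]]; apply/badP.
- by constructor 1; exists v; rewrite // mnmDE; lia.
- by constructor 2; exists v; rewrite vt vX mnmDE; split=> //; lia.
- by constructor 3; exists x, y; split=> //; apply: lepm_trans le (lem_addr _ _).
Qed.

Lemma folded_bad_ideal t : is_ideal (folded_bad t).
Proof.
split=> [|p q bp bq|p q bq]; rewrite /folded_bad.
- by rewrite comp_mpoly0 => M; rewrite msupp0.
- rewrite comp_mpolyD => M /msuppD_le; rewrite mem_cat => /orP[]; [exact: bp|exact: bq].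
- rewrite rmorphM => M /msuppM_le /allpairsP[[M1 M2] /= [_ /bq bM2 ->]].
  by rewrite addmC; apply: badD.
Qed.

Lemma fold_varX t x : x \in X -> fold_var t x = x.
Proof. by move=> xX; rewrite /fold_var (negPf (mX xX)). Qed.

Lemma fold_var_m t y : y \in X -> fold_var t (m y) = if y \in t then y else m y.
Proof. by move=> yX; rewrite /fold_var mK yX. Qed.

Lemma UU_le u v M : u != v ->
  (U u + U v <= M)%MM = (M (enum_rank u) != 0%N) && (M (enum_rank v) != 0%N).
Proof.
move=> uv; apply/mnm_lepP/andP => [le|[Mu Mv] i].
  by split; rewrite -lt0n; apply: leq_trans (le _);
    rewrite mnmDE !mnm1E eqxx ?addn1.
rewrite mnmDE !mnm1E; case: eqP => [<-|_]; last by case: eqP => // <-; rewrite add0n lt0n.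
by rewrite (inj_eq enum_rank_inj) eq_sym (negPf uv) addn0 lt0n.
Qed.

Lemma mXneq x y : x \in X -> y \in X -> (x == m y) = false.
Proof. by move=> xX yX; apply/negP => /eqP xy; move: (mX yX); rewrite -xy xX. Qed.

Lemma SR_folded_bad t p : SR D p -> folded_bad t p.
Proof.
move=> Dp; apply: (Dp _ (folded_bad_ideal t)) => {Dp p} _ [F' F'D ->].
rewrite /folded_bad tsubst_face mprodXE => M; rewrite msuppX inE => /eqP->.
move: F'D; rewrite DE negb_and => /orP[/subsetPn[v vF vW]|].
  apply/badP; constructor 1; exists v => //.
  rewrite (bigD1 v) //= mnmDE /fold_var ifN ?mnm1E ?eqxx //.
  apply: contra vW => /andP[mvX _]; rewrite -[v]mK; exact: mXW.
case: (boolP (F' \subset W)) => [/subsetP F'W|/subsetPn[v vF vW] _]; last first.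
  apply/badP; constructor 1; exists v => //.
  rewrite (bigD1 v) //= mnmDE /fold_var ifN ?mnm1E ?eqxx //.
  apply: contra vW => /andP[mvX _]; rewrite -[v]mK; exact: mXW.
move=> /forall_inPn[u uF /forall_inPn[v vF]]; rewrite negbK => euv.
wlog /andP[uX mvX] : u v uF vF euv / (u \in X) && (m v \in X).
  case/orP: (edgeW (F'W _ uF) (F'W _ vF) euv) => [uv|vu].
    by move/(_ u v); apply.
  by move/(_ v u); apply=> //; rewrite e_sym.
apply/badP; constructor 3; exists u, (m v); rewrite mK; split=> //.
rewrite -{1}(fold_varX t uX) (bigD1 u) //= (bigD1 v) /=; last first.
  by rewrite vF; apply: contraTneq euv => ->; rewrite e_irr.
by rewrite addmA lem_addr.
Qed.

Lemma in_F v : (v \in F) = (v \in W) && (m v \notin X).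
Proof.
rewrite !inE; have [vX|vX] := boolP (v \in X); last by [].
by rewrite XW // mX.
Qed.

Lemma param_folded_bad t v : v \in t -> v \in F -> folded_bad t (param v).
Proof.
rewrite in_F => vt /andP[vW mvX]; rewrite /folded_bad /param.
case: (boolP (v \in X)) => vX M.
  rewrite comp_mpolyB !tsubst_var /fold_mvar fold_varX // fold_var_m // vt subrr msupp0.
  by [].
rewrite tsubst_var /fold_mvar /fold_var (negPf mvX) msuppX inE => /eqP->.
by apply/badP; constructor 2; exists v; rewrite mnm1E eqxx.
Qed.

(** Generators fold to bad polynomials. Conversely [p] is congruent to its folding modulo the
    parameters, so it is enough to place each bad monomial in the ideal. *)
Lemma folded_badE t p : {subset t <= F} ->
  ideal_add_seq (SR D) [seq param v | v <- t] p <-> folded_bad t p.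
Proof.
move=> tF; split.
  apply: ideal_add_seq_sub; first exact: folded_bad_ideal.
    exact: SR_folded_bad.
  by move=> _ /mapP[v vt ->]; apply: param_folded_bad => //; apply: tF.
move=> bp; set Q := ideal_add_seq _ _.
have idQ : is_ideal Q by apply: ideal_gen_ideal.
have Qt v : v \in t -> Q (param v).
  by move=> vt; apply: ideal_add_seq_seq; apply: map_f.
have Qsub : Q (p - tsubst (fold_mvar t) p).
  apply: tsubst_congr => // v; rewrite /fold_mvar /fold_var; case: ifP => [/andP[mvX mvt]|_].
    by rewrite -opprB; apply: (idealN idQ); have := Qt _ mvt; rewrite /param mvX mK.
  by rewrite subrr; apply: ideal0.
rewrite -[p](subrK (tsubst (fold_mvar t) p)); apply: (idealD idQ Qsub).
apply: (ideal_mpoly idQ) => M /bp /badP[[v vW Mv]|[v [vt vX Mv]]|].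
- apply: ideal_add_seq_mem; apply: SR_mpolyX; rewrite DE negb_and.
  by apply/orP; left; apply/subsetPn; exists v; rewrite ?inE.
- rewrite -(@submK _ (U v) M) ?lep1mP // mpolyXD; apply: (idealMl _ idQ).
  by have := Qt v vt; rewrite /param (negPf vX).
case=> x [y [xX yX exy le]]; rewrite -(submK le) mpolyXD; apply: (idealMl _ idQ).
have Qxy : Q (V x * V (m y)).
  apply: ideal_add_seq_mem; rewrite /V -mpolyXD; apply: SR_mpolyX.
  rewrite DE negb_and; apply/orP; right.
  apply/forall_inPn; exists x; first by rewrite inE mnmDE mnm1E eqxx.
  apply/forall_inPn; exists (m y); last by rewrite negbK.
  by rewrite inE mnmDE !mnm1E eqxx addn1.
(* For [y] in [t] the variables of [y] and [m y] differ by a parameter, so the folded edge reduces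
   to the original one. *)
rewrite mpolyXD fold_var_m //; case: ifP => [/Qt|_] //.
rewrite /param yX => Qy; rewrite -['X_(enum_rank y)](subrK (V (m y))) mulrDr.
by apply: (idealD idQ) Qxy; apply: (idealMl _ idQ).
Qed.

(** Such a [v] supplies neither of the first two kinds of generator, so removing it can only affect
    folded edges. *)
Lemma bad_drop t v M : v \in W -> (v \in t -> v \in X) ->
  (forall x y, x \in X -> y \in X -> e x (m y) ->
    (U x + U (fold_var t (m y)) <= M + U v)%MM -> bad t M) ->
  bad t (M + U v)%MM -> bad t M.
Proof.
move=> vW vt bM /badP[[w wW Mw]|[w [wt wX Mw]]|[x [y [xX yX exy /bM]]]]; last by apply.
  apply/badP; constructor 1; exists w => //; move: Mw; rewrite mnmDE mnm1E.
  rewrite (inj_eq enum_rank_inj); have [vw|_] := eqVneq v w; last by rewrite addn0.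
  by rewrite -vw vW in wW.
apply/badP; constructor 2; exists w; split=> //; move: Mw; rewrite mnmDE mnm1E.
rewrite (inj_eq enum_rank_inj); have [vw|_] := eqVneq v w; last by rewrite addn0.
by rewrite -vw in wX wt; rewrite vt in wX.
Qed.

Lemma UU_le_drop v x w M : x != v -> w != v ->
  (U x + U w <= M + U v)%MM -> (U x + U w <= M)%MM.
Proof.
move=> xv wv /mnm_lepP le; apply/mnm_lepP => i; have := le i; rewrite !mnmDE !mnm1E.
have [<-|_] := eqVneq (enum_rank v) i; last by rewrite addn0.
by rewrite !(inj_eq enum_rank_inj) (negPf xv) (negPf wv).
Qed.

(** The hypothesis on [x] and [y] says that no folded edge is the square of [v]. *)
Lemma bad_sqfree t v M : v \in W -> (v \in t -> v \in X) ->
  (forall x y, x \in X -> y \in X -> (x != v) || (fold_var t (m y) != v)) ->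
  bad t (M + U v + U v)%MM -> bad t (M + U v)%MM.
Proof.
move=> vW vt sq; apply: bad_drop => // x y xX yX exy le.
apply/badP; constructor 3; exists x, y; split=> //; apply/mnm_lepP => i.
have /mnm_lepP/(_ i) := le; rewrite !mnmDE !mnm1E.
case: (eqVneq (enum_rank v) i) => [<- _|_]; last by rewrite !addn0.
rewrite !(inj_eq enum_rank_inj) addn1.
by case/orP: (sq x y xX yX) => /negPf->; rewrite ?addn0; apply: leq_trans (leq_b1 _) _.
Qed.

(** Unless [M] is visibly bad, there are [x' <= v] and [v <= y] with [x'] and the folding of [m y]
    dividing [M], and transitivity yields a folded edge. It is not a square: [x' = y] in [t] would
    give [v = y] by antisymmetry, but [v] is not in [t]. *)
Lemma bad_join t v M : {subset t <= F} -> v \in X -> v \notin t ->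
  bad t (M + U v)%MM -> bad t (M + U (m v))%MM -> bad t M.
Proof.
move=> tF vX vt bMv bMmv.
have mvt : m v \in t -> m v \in X by move/tF; rewrite in_F mK vX andbF.
apply: (bad_drop (XW vX) _ _ bMv) => [|x y xX yX exy]; first by move=> _.
have fyv : fold_var t (m y) != v.
  rewrite fold_var_m //; case: ifPn => yt; first by apply: contraNneq vt => <-.
  by rewrite eq_sym mXneq.
have [xv|xv] := eqVneq x v; last first.
  by move/(UU_le_drop xv fyv) => le; apply/badP; constructor 3; exists x, y.
rewrite {x}xv in xX exy *; rewrite UU_le 1?eq_sym // => /andP[_]; rewrite mnmDE mnm1E.
rewrite (inj_eq enum_rank_inj) [v == _]eq_sym (negPf fyv) addn0 => My.
apply: (bad_drop (mXW vX) mvt _ bMmv) => x' y' x'X y'X ex'y'.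
have x'mv : x' != m v by rewrite mXneq.
have [fy'|fy'] := eqVneq (fold_var t (m y')) (m v); last first.
  by move/(UU_le_drop x'mv fy') => le; apply/badP; constructor 3; exists x', y'.
have y'v : y' = v.
  move: fy'; rewrite fold_var_m //; case: ifP => _ => [/eqP|/(can_inj mK)//].
  by rewrite mXneq.
rewrite fy' UU_le // mnmDE mnm1E (inj_eq enum_rank_inj) [m v == _]eq_sym (negPf x'mv) addn0.
case/andP=> Mx' _; rewrite y'v in ex'y'.
apply/badP; constructor 3; exists x', y; split=> //; first exact: le_trans exy.
rewrite UU_le ?Mx' //; rewrite fold_var_m //; case: ifPn => yt; last by rewrite mXneq.
by apply: contraNneq vt => x'y; rewrite (le_anti vX x'X) // x'y.
Qed.

(** The parameter folds to a difference of two variables for [v] in [X] and to a single variable for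
    [v] isolated. *)
Lemma param_nzd t v g : {subset t <= F} -> v \in F -> v \notin t ->
  folded_bad t (param v * g) -> folded_bad t g.
Proof.
move=> tF; rewrite in_F => /andP[vW mvX] vt; rewrite /folded_bad rmorphM /param.
case: (boolP (v \in X)) => vX /=.
  rewrite comp_mpolyB !tsubst_var /fold_mvar fold_varX // fold_var_m // (negPf vt).
  apply: mpolyXUB_nzd => [M M'||M|M|M]; first exact: badD.
  - by rewrite (inj_eq enum_rank_inj) mXneq.
  - apply: bad_sqfree => // x y xX yX; apply/orP; right.
    rewrite fold_var_m //; case: ifPn => yt; first by apply: contraNneq vt => <-.
    by rewrite eq_sym mXneq.
  - apply: bad_sqfree => [||x y xX yX]; first exact: mXW.
      by move/tF; rewrite in_F mK vX andbF.
    by rewrite mXneq.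
  - exact: bad_join.
rewrite tsubst_var /fold_mvar /fold_var (negPf mvX) /=; apply: mpolyXU_nzd => M.
apply: bad_drop => //; first by rewrite (negPf vt).
move=> x y xX yX exy le; apply/badP; constructor 3; exists x, y; split=> //.
apply: UU_le_drop le; first by apply: contraNneq vX => <-.
rewrite fold_var_m //; case: ifP => _; first by apply: contraNneq vX => <-.
by apply: contraNneq mvX => <-; rewrite mK.
Qed.

Lemma poset_regular_seq : homog_regular_seq (SR D) [seq param v | v <- enum F].
Proof.
have tF i : {subset take i (enum F) <= F}.
  by move=> v /mem_take; rewrite mem_enum.
split; last first.
  move=> _ /mapP[v _ ->]; exists 1%N => //; rewrite /param.
  by case: ifP => _; rewrite ?rpredB // dhomogX /= mdeg1.
split=> [i|].
  rewrite size_map => iF g; rewrite -!map_take !folded_badE //.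
  have /card_gt0P[v0 _] : (0 < #|F|)%N by rewrite cardE; apply: leq_ltn_trans iF.
  rewrite (nth_map v0) //; apply: param_nzd => //; first by rewrite -mem_enum mem_nth.
  have := enum_uniq F; rewrite -{1}(cat_take_drop i (enum F)) cat_uniq.
  by case/and3P=> _ /hasPn + _; apply; rewrite (drop_nth v0 iF) mem_head.
rewrite folded_badE => [|v]; last by rewrite mem_enum.
rewrite /folded_bad comp_mpoly1 => /(_ 0%MM); rewrite -mpolyC1 msupp1 mem_head.
case/(_ isT)/badP=> [[v _]|[v [_ _]]|[x [y [_ _ _]]]]; rewrite ?mnm0E //.
by move=> /mnm_lepP/(_ (enum_rank x)); rewrite mnm0E mnmDE mnm1E eqxx.
Qed.

Lemma poset_complex_CM : cohen_macaulay k D.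
Proof.
apply: (CM_criterion _ _ poset_regular_seq); last by rewrite size_map cardE.
- move=> F'; rewrite DE => /andP[/subsetP F'W /forall_inP F'e].
  (* Moving vertices outside [F] to their partners is injective on an independent set, since
     partners are adjacent. *)
  pose r v := if v \in F then v else m v.
  have rX v : v \in F' -> v \notin F -> m v \in X.
    by move=> /F'W vW; rewrite in_F vW negbK.
  rewrite -(card_in_imset (f := r)) => [|u v uF' vF'].
    apply/subset_leq_card/subsetP => _ /imsetP[v vF' ->]; rewrite /r.
    by case: ifPn => // /(rX v vF') mvX; rewrite inE mvX.
  wlog vF : u v uF' vF' / v \in F.
    move=> wl; have [vF|vF] := boolP (v \in F); first exact: wl.
    have [uF|uF] := boolP (u \in F); first by move/esym/wl->.
    by rewrite /r (negPf uF) (negPf vF) => /(can_inj mK).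
  rewrite /r vF; case: ifPn => // uF; have muX := rX u uF' uF => muv.
  have /forall_inP/(_ u uF')/negP[] := F'e v vF'.
  by rewrite -muv -{2}[u]mK le_refl.
- move=> F' /subsetP F'F; rewrite DE; apply/andP; split.
    by apply/subsetP => v /F'F; rewrite in_F => /andP[].
  apply/forall_inP => u /F'F; rewrite in_F => /andP[uW muX].
  apply/forall_inP => v /F'F; rewrite in_F => /andP[vW mvX].
  by apply/negP => /(edgeW uW vW); rewrite (negPf muX) (negPf mvX) !andbF.
Qed.

End PosetComplex.

(** * Unmixed bipartite graphs *)

(** Vertices outside [F] move to their partners, which are not in [F'], so nothing collides. The
    bound counts only the pairs that [F'] meets, so that a missed pair makes it strict. *)
Lemma card_fold (T : finType) (m : T -> T) (F F' : {set T}) : involutive m ->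
  (forall v, v \in F' -> v \notin F -> (m v \in F) && (m v \notin F')) ->
  #|F'| <= #|[set v in F | (v \in F') || (m v \in F')]|.
Proof.
move=> mK foldF; pose r v := if v \in F then v else m v.
rewrite -(card_in_imset (f := r)) => [|u v uF' vF'].
  apply/subset_leq_card/subsetP => _ /imsetP[v vF' ->]; rewrite /r inE.
  by case: ifPn => [->|/(foldF v vF')/andP[-> _]]; rewrite ?mK vF' ?orbT.
rewrite /r; case: ifPn => uF; case: ifPn => vF //.
- by move=> uv; have := foldF v vF' vF; rewrite -uv uF'  andbF.
- by move=> uv; have := foldF u uF' uF; rewrite uv vF' andbF.
- exact: (can_inj mK).
Qed.

(** * The preorder of an unmixed bipartite graph and its classes *)

Section Graph.
Variables (V : finType) (e : rel V).
Hypothesis e_sym : ssrbool.symmetric e.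
Hypothesis e_irr : irreflexive e.

Lemma IndP (F : {set V}) : reflect {in F &, forall u v, ~~ e u v} (F \in Ind e).
Proof.
rewrite inE; apply: (iffP forall_inP) => [Fe u v uF vF|Fe u uF].
  by have /forall_inP/(_ v vF) := Fe u uF.
by apply/forall_inP => v; apply: Fe.
Qed.

Definition outside (F : {set V}) : {set V} :=
  [set v | (v \notin F) && [forall u in F, ~~ e u v]].

Lemma outsideP (F : {set V}) v :
  reflect (v \notin F /\ forall u, u \in F -> ~~ e u v) (v \in outside F).
Proof. by rewrite inE; apply: (iffP andP) => -[vF /forall_inP]. Qed.

Lemma link_Ind (F H : {set V}) : F \in Ind e ->
  (H \in link (Ind e) F) =
  (H \subset outside F) && [forall u in H, forall v in H, ~~ e u v].
Proof.
move=> /IndP Fe; rewrite inE; apply/andP/andP => -[].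
  move=> HF /IndP HFe; split; last first.
    by apply/forall_inP => u uH; apply/forall_inP => v vH; apply: HFe; rewrite inE ?uH ?vH.
  apply/subsetP => v vH; apply/outsideP; split; first by rewrite (disjointFr HF).
  by move=> u uF; apply: HFe; rewrite inE ?uF ?vH ?orbT.
move=> /subsetP HF /forall_inP He; split.
  by rewrite disjoint_subset; apply/subsetP => v /HF/outsideP[].
apply/IndP => u v /setUP[uH|uF] /setUP[vH|vF].
- by have /forall_inP/(_ v vH) := He u uH.
- by rewrite e_sym; have /HF/outsideP[_] := uH; apply.
- by have /HF/outsideP[_] := vH; apply.
- exact: Fe.
Qed.

(** A perfect matching is constrained only at non-isolated vertices; the identity elsewhere makes it
    an involution. *)
Lemma perfect_matching_involutive m0 : perfect_matching e m0 ->
  exists2 m, involutive m & forall u v, e u v -> e u (m u) /\ m u = m0 u.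
Proof.
move=> pm; exists (fun v => if [exists u, e v u] then m0 v else v) => [v|u v euv].
  have [ev|/negPf nev] := boolP [exists u, e v u]; last by rewrite !nev.
  have [evm mv] := pm v ev.
  by rewrite ifT //; apply/existsP; exists v; rewrite e_sym.
have eu : [exists w, e u w] by apply/existsP; exists v.
by rewrite eu; have [] := pm u eu.
Qed.

Lemma is_Knn_sym n A B : is_Knn e n A B -> is_Knn e n B A.
Proof.
case=> cA cB AB [m pm mA]; split=> // [a b aB bA|]; first by rewrite e_sym AB.
exists m => //; rewrite -mA -imset_comp -[RHS]imset_id; apply: eq_in_imset => a aA /=.
have [|_ //] := pm a; apply/existsP; exists (m a); apply: AB => //.
by rewrite -mA imset_f.
Qed.

Variables (S : {set V}) (m : V -> V).
Hypothesis bip : forall u v, e u v -> (u \in S) = (v \notin S).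
Hypothesis mK : involutive m.
Hypothesis em : forall u v, e u v -> e u (m u).
Hypothesis e_unmixed : unmixed e.

(** The condition [e v (m v)] selects the non-isolated vertices of [S]. *)
Let X : {set V} := [set v in S | e v (m v)].
(** This is [X] together with the isolated vertices. *)
Let F0 : {set V} := [set v | m v \notin X].

Lemma in_X x : x \in X -> [/\ x \in S, m x \notin S & e x (m x)].
Proof. by rewrite inE => /andP[xS ex]; rewrite -(bip ex). Qed.

Lemma m_notin_X x : x \in X -> m x \notin X.
Proof. by case/in_X=> _ mxS _; rewrite inE (negPf mxS). Qed.

Lemma edge_X u v : e u v -> u \in S -> (u \in X) && (m v \in X).
Proof.
move=> euv uS; have evm : e v (m v) by apply: (@em v u); rewrite e_sym.
rewrite !inE uS (em euv) mK e_sym evm andbT /=.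
by rewrite -[_ \in _]negbK -(bip evm) -(bip euv) uS.
Qed.

Lemma edge_cases u v : e u v ->
  (u \in X) && (m v \in X) || (v \in X) && (m u \in X).
Proof.
move=> euv; have [uS|uS] := boolP (u \in S); first by rewrite edge_X.
have evu : e v u by rewrite e_sym.
by rewrite orbC edge_X // (bip evu).
Qed.

Lemma in_F0 v : (v \in F0) = (m v \notin X).
Proof. by rewrite [LHS]inE. Qed.

Lemma F0_Ind : F0 \in Ind e.
Proof.
apply/IndP => u v; rewrite !in_F0 => uX vX; apply/negP => /edge_cases.
by rewrite (negPf vX) (negPf uX) !andbF.
Qed.

Lemma Ind_card_fold (H : {set V}) : H \in Ind e ->
  #|H| <= #|[set v in F0 | (v \in H) || (m v \in H)]|.
Proof.
move=> /IndP He; apply: card_fold => // v vH; rewrite in_F0 negbK => mvX.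
rewrite in_F0 m_notin_X //=; apply: contraTN mvX => mvH.
by apply/negP => /in_X[_ _]; rewrite mK; apply/negP/He.
Qed.

Lemma Ind_card (H : {set V}) : H \in Ind e -> #|H| <= #|F0|.
Proof.
move=> /Ind_card_fold/leq_trans; apply; apply/subset_leq_card/subsetP => v.
by rewrite inE => /andP[].
Qed.

Lemma F0_facet : facet (Ind e) F0.
Proof.
apply/maxsetP; split=> [|H HI sub]; first exact: F0_Ind.
by apply/esym/eqP; rewrite eqEcard sub Ind_card.
Qed.

Lemma gdim_card d : gdim e = (d%:Z - 1)%R -> d = #|F0|.
Proof.
move=> gd; have -> : d = \max_(F in Ind e) #|F|.
  by apply/eqP; rewrite -eqz_nat -(inj_eq (addIr (- 1 : int)%R)) -gd.
apply/eqP; rewrite eqn_leq; apply/andP; split.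
  by apply/bigmax_leqP => H; apply: Ind_card.
exact: (leq_bigmax_cond _ F0_Ind).
Qed.

Lemma le_X_refl x : x \in X -> e x (m x).
Proof. by case/in_X. Qed.

(* Otherwise a facet containing x and m z would contain neither y nor m y,
   and would be smaller than F0. *)
Lemma le_X_trans x y z : x \in X -> y \in X -> z \in X ->
  e x (m y) -> e y (m z) -> e x (m z).
Proof.
move=> xX yX zX exy eyz; apply: contraT => nexz.
have : [set x; m z] \in Ind e.
  apply/IndP => u v /set2P[]-> /set2P[]->; rewrite ?e_irr //.
  by rewrite e_sym.
case/(@maxset_exists _ [pred H | H \in Ind e]) => G maxG /subsetP sub.
have GI : G \in Ind e by have /maxsetp := maxG.
have /IndP Ge := GI.
have xG : x \in G by apply/sub/set21.
have zG : m z \in G by apply/sub/set22.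
have := Ind_card_fold GI; rewrite (e_unmixed maxG F0_facet) leqNgt => /negP[].
apply: proper_card; apply/properP; split; first by apply/subsetP => v; rewrite inE => /andP[].
exists y; first by rewrite in_F0 m_notin_X.
rewrite inE negb_and negb_or; apply/orP; right; apply/andP; split.
  by apply: contraL eyz => yG; apply: Ge.
by apply: contraL exy => yG; apply: Ge.
Qed.

(** The equivalence class of [x] in the preorder. *)
Definition cls x : {set V} := [set y in X | e x (m y) && e y (m x)].

Lemma clsP x y : reflect [/\ y \in X, e x (m y) & e y (m x)] (y \in cls x).
Proof. by rewrite [y \in cls x]inE; exact: and3P. Qed.

Lemma cls_le x y z : x \in X -> y \in cls x -> z \in cls x -> e y (m z).
Proof. by move=> xX /clsP[yX _ yx] /clsP[zX xz _]; apply: le_X_trans xz. Qed.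

(* The permutation m \o m' only moves elements up, hence stays in one class. *)
Lemma other_matching_cls m' x : perfect_matching e m' -> x \in X ->
  m (m' x) \in cls x.
Proof.
case/perfect_matching_involutive=> m1 m1K em1 xX.
have <- : m1 x = m' x by have [] := em1 x (m x) (le_X_refl xX).
pose s v := m (m1 v); have s_inj : injective s.
  by move=> u v; rewrite /s => /(can_inj mK)/(can_inj m1K).
have sX v : v \in X -> (s v \in X) && e v (m (s v)).
  move=> vX; have [vS _ ev] := in_X vX; have [e1 _] := em1 _ _ ev.
  by rewrite mK e1; have /andP[_ ->] := edge_X e1 vS.
have iterX v j : v \in X -> (iter j s v \in X) && e v (m (iter j s v)).
  move=> vX; elim: j => [|j /andP[IH1 IH2]] /=; first by rewrite vX le_X_refl.
  by have /andP[sX1 sX2] := sX _ IH1; rewrite sX1 (le_X_trans vX IH1 sX1).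
apply/clsP; have /andP[sxX xsx] := sX x xX; split=> //.
(* Continuing around the cycle of [s] leads from [s x] back to [x], hence [s x <= x]. *)
have /andP[_] := iterX (s x) (fingraph.order s x).-1 sxX.
by rewrite -iterSr prednK ?order_gt0 // iter_order.
Qed.

(** For [b] in [A], [m' b] is the [m]-partner of an element equivalent to [b], so an edge from [a]
    to [m' b] means [a <= b]. Thus all elements of [A] are equivalent. *)
Lemma is_Knn_sub n A B x : is_Knn e n A B -> x \in X -> x \in A ->
  A :|: B \subset cls x :|: m @: cls x.
Proof.
case=> cA cB AB [m' pm mA] xX xA; have [xS _ _] := in_X xX.
have m'B a : a \in A -> m' a \in B by move=> aA; rewrite -mA imset_f.
(* [a] and [x] have a common neighbour in [B], hence lie on the same side. *)
have AX a : a \in A -> a \in X.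
  move=> aA; have e1 := AB _ _ aA (m'B x xA); have e2 := AB _ _ xA (m'B x xA).
  have aS : a \in S by rewrite (bip e1) -(bip e2).
  by have /andP[] := edge_X e1 aS.
have le_A a b : a \in A -> b \in A -> e a (m b).
  move=> aA bA; have [sX bs sb] := clsP _ _ (other_matching_cls pm (AX b bA)).
  by apply: (le_X_trans (AX a aA) sX (AX b bA) _ sb); rewrite mK AB ?m'B.
have A_cls a : a \in A -> a \in cls x.
  by move=> aA; apply/clsP; split; [apply: AX | apply: le_A | apply: le_A].
apply/subsetP => v; rewrite inE => /orP[vA|]; first by rewrite inE A_cls.
rewrite -mA => /imsetP[a aA ->]; rewrite inE; apply/orP; right.
rewrite -[m' a]mK imset_f //.
have [sX bs sb] := clsP _ _ (other_matching_cls pm (AX a aA)).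
have aX := AX a aA; apply/clsP; split=> //.
  exact: (le_X_trans xX aX sX (le_A x a xA aA) bs).
exact: (le_X_trans sX aX xX sb (le_A a x aA xA)).
Qed.

Lemma is_Knn_subU n A B x : is_Knn e n A B -> x \in X -> x \in A :|: B ->
  A :|: B \subset cls x :|: m @: cls x.
Proof.
move=> K xX /setUP[xA|xB]; first exact: is_Knn_sub K xX xA.
by rewrite [A :|: B]setUC; apply: is_Knn_sub (is_Knn_sym K) xX xB.
Qed.

Lemma matching_perfect : perfect_matching e m.
Proof. by move=> v /existsP[u evu]; split; [apply: em evu | apply: mK]. Qed.

Lemma cls_Knn x : x \in X -> is_Knn e #|cls x| (cls x) (m @: cls x).
Proof.
move=> xX; split=> // [|a b ac /imsetP[c cc ->]|]; last by exists m => //; apply: matching_perfect.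
  by rewrite card_imset //; apply: can_inj mK.
exact: cls_le cc.
Qed.

Lemma cls_self x : x \in X -> x \in cls x.
Proof. by move=> xX; apply/clsP; split=> //; apply: le_X_refl. Qed.

(** A larger subgraph still contains [x], so [is_Knn_subU] confines it to the class. *)
Lemma cls_maximal x : x \in X -> maximal_Knn e #|cls x| (cls x) (m @: cls x).
Proof.
move=> xX; split=> [|n A B K sub]; first exact: cls_Knn.
apply/eqP; rewrite eqEsubset sub andbT; apply: (is_Knn_subU K xX).
by apply/(subsetP sub)/setUP; left; apply: cls_self.
Qed.

(** * Links of large faces *)

Section LinkCM.
Variables (k : fieldType) (n : nat) (F : {set V}).
Hypothesis FI : F \in Ind e.
Hypothesis n_min : forall x, x \in X -> 2 <= #|cls x| -> n <= #|cls x|.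
Hypothesis F_large : #|F0| < #|F| + n.

(** A member of the class lying in [F] would be adjacent to [m x], and by transitivity a neighbour
    in [F] of a member would be adjacent to [x]. *)
Lemma outside_cls x : x \in X -> x \in outside F -> m x \in outside F ->
  cls x \in link (Ind e) F.
Proof.
move=> xX /outsideP[xF xFe] /outsideP[mxF mxFe]; rewrite link_Ind //.
apply/andP; split.
  apply/subsetP => y /clsP[yX exy eyx]; apply/outsideP; split.
    by apply: contraL eyx => /mxFe.
  move=> u uF; apply/negP => euy; have [yS _ _] := in_X yX.
  have eyu : e y u by rewrite e_sym.
  have /andP[_ muX] := edge_X eyu yS.
  have := le_X_trans xX yX muX exy; rewrite mK => /(_ eyu).
  by rewrite e_sym (negPf (xFe u uF)).
apply/forall_inP => y /clsP[yX _ _]; apply/forall_inP => z /clsP[zX _ _].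
have [yS _ _] := in_X yX; have [zS _ _] := in_X zX.
by apply/negP => /bip; rewrite yS zS.
Qed.

Lemma link_CM : cohen_macaulay k (link (Ind e) F).
Proof.
pose W := outside F; pose X' := [set x in X | (x \in W) && (m x \in W)].
have X'P x : x \in X' -> [/\ x \in X, x \in W & m x \in W].
  by rewrite inE => /and3P.
have X'X x : x \in X' -> x \in X by case/X'P.
apply: (@poset_complex_CM k V e _ W X' m) => //.
- by move=> H; apply: link_Ind.
- by move=> x /X'P[].
- by move=> x /X'P[].
- by move=> x /X'X /m_notin_X; apply: contra; apply: X'X.
(* A surviving edge keeps the partners of both its ends: if one were adjacent to a vertex of [F],
   transitivity would make that vertex adjacent to [u] or [v]. *)
- suff edgeX' u v : u \in W -> v \in W -> e u v -> u \in X -> m v \in X ->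
      (u \in X') && (m v \in X').
    move=> u v uW vW euv; case/orP: (edge_cases euv) => /andP[uX mvX].
      by rewrite edgeX'.
    by apply/orP; right; apply: edgeX' => //; rewrite e_sym.
  move=> uW vW euv uX mvX; have [uS muS emu] := in_X uX.
  have [mvS _ emv] := in_X mvX; rewrite mK in emv.
  have [_ uFe] := outsideP _ _ uW; have [_ vFe] := outsideP _ _ vW.
  have muW : m u \in W.
    apply/outsideP; split=> [|w wF].
      by apply: contraL emu => /uFe; rewrite e_sym.
    apply/negP => ew; have wS : w \in S by rewrite (bip ew).
    have /andP[wX _] := edge_X ew wS.
    by have := le_X_trans wX uX mvX ew; rewrite mK (negPf (vFe w wF)) => /(_ euv).
  have mvW : m v \in W.
    apply/outsideP; split=> [|w wF]; first by apply: contraL emv => /vFe.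
    apply/negP; rewrite e_sym => ew; have /andP[_ mwX] := edge_X ew mvS.
    have := le_X_trans uX mvX mwX; rewrite !mK => /(_ euv ew).
    by rewrite e_sym (negPf (uFe w wF)).
  by rewrite /X' inE uX uW muW inE mvX mvW mK vW.
- by move=> x /X'X /le_X_refl.
- by move=> x y z /X'X xX /X'X yX /X'X zX; apply: le_X_trans.
- move=> x y xX' /X'X yX exy eyx; have [xX xW mxW] := X'P x xX'.
  apply/eqP; apply: contraT => xy.
  (* Two equivalent elements force a class of at least [n] elements; joined to [F] it would give a
     face larger than [F0]. *)
  have : 2 <= #|cls x|.
    have <- : #|[set x; y]| = 2 by rewrite cards2 xy.
    apply/subset_leq_card/subsetP => z /set2P[]->.
      exact: cls_self.
    exact/clsP.
  move/(n_min xX) => ncls; have := outside_cls xX xW mxW.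
  rewrite inE => /andP[dis /Ind_card]; rewrite cardsU (disjoint_setI0 dis) cards0.
  by move: F_large ncls; rewrite subn0; lia.
Qed.

End LinkCM.

(* X_U, Y_D and the isolated vertices, where D and U are the indices strictly
   below, resp. not below, the class of x. *)
Definition cls_cofacet x : {set V} :=
  [set v | if v \in X then ~~ e v (m x)
           else (m v \in X) ==> e (m v) (m x) && ~~ e x v].

(** * A face whose link consists of two disjoint simplices *)

Section Cofacet.
Variable x : V.
Hypothesis xX : x \in X.
Let F := cls_cofacet x.

Lemma cofacetX v : v \in X -> (v \in F) = ~~ e v (m x).
Proof. by move=> vX; rewrite [LHS]inE vX. Qed.

Lemma cofacetY v : v \in X -> (m v \in F) = e v (m x) && ~~ e x (m v).
Proof. by move=> vX; rewrite [LHS]inE (negPf (m_notin_X vX)) mK vX. Qed.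

Lemma cofacetZ v : v \notin X -> m v \notin X -> v \in F.
Proof. by move=> /negPf vX /negPf mvX; rewrite inE vX mvX. Qed.

(** An edge would put some [u] that is not below [x] under some [w <= x], against transitivity. *)
Lemma cofacet_Ind : F \in Ind e.
Proof.
suff nFX u v : u \in F -> v \in F -> u \in X -> m v \in X -> ~~ e u v.
  apply/IndP => u v uF vF; apply/negP => euv.
  case/orP: (edge_cases euv) => /andP[uX vX].
    by have := nFX u v uF vF uX vX; rewrite euv.
  by have := nFX v u vF uF uX vX; rewrite e_sym euv.
rewrite -{1 3}[v]mK; move: (m v) => w uF wF uX wX; apply/negP => euw.
move: uF wF; rewrite cofacetX // cofacetY // => /negP nux /andP[wx _]; apply: nux.
exact: le_X_trans euw wx.
Qed.

(** Folding partners back, [F] covers all of [F0] outside the class of [x]. *)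
Lemma cofacet_card : #|F0| <= #|F| + #|cls x|.
Proof.
pose r v := if v \in F0 then v else m v.
apply: leq_trans (leq_add (leq_imset_card r F) (leqnn _)).
apply: leq_trans (leq_card_setU _ _); apply/subset_leq_card/subsetP => v vF0.
have mvX : m v \notin X by rewrite -in_F0.
have rv : r v = v by rewrite /r vF0.
apply/setUP; have [vX|vX] := boolP (v \in X); last first.
  by left; rewrite -rv imset_f // cofacetZ.
have [vx|vx] := boolP (e v (m x)); last by left; rewrite -rv imset_f // cofacetX.
have [xv|xv] := boolP (e x (m v)); first by right; apply/clsP.
left; have <- : r (m v) = v by rewrite /r in_F0 mK vX.
by rewrite imset_f // cofacetY // vx.
Qed.

Lemma outside_cofacet v : (v \in outside F) = (v \in cls x :|: m @: cls x).
Proof.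
apply/outsideP/setUP => [[vF Fv]|].
  have [vX|vX] := boolP (v \in X).
    left; move: vF; rewrite cofacetX // negbK => vx; apply/clsP; split=> //.
    apply: contraT => xv; have := Fv (m v); rewrite cofacetY // vx xv => /(_ isT).
    by rewrite e_sym (le_X_refl vX).
  have [mvX|mvX] := boolP (m v \in X); last by rewrite cofacetZ in vF.
  right; rewrite -[v]mK imset_f //; have := Fv (m v); rewrite cofacetX //.
  have := le_X_refl mvX; rewrite mK => -> nvx.
  have vx : e (m v) (m x) by apply: contraT => /nvx.
  move: vF; rewrite -[v in v \notin F]mK cofacetY // vx /= negbK mK => xv.
  by apply/clsP; rewrite mK.
case=> [/clsP[vX xv vx]|/imsetP[c /clsP[cX xc cx] ->]]; split.
- by rewrite cofacetX // vx.
- move=> u uF; apply: contraL uF; rewrite e_sym => evu; have [vS _ _] := in_X vX.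
  have /andP[_ muX] := edge_X evu vS.
  by rewrite -[u]mK cofacetY // (le_X_trans xX vX muX xv) ?andbF // mK.
- by rewrite cofacetY // xc andbF.
- move=> u uF; apply: contraL uF => euc; have [_ cS _] := in_X cX.
  have uS : u \in S by rewrite (bip euc).
  have /andP[uX _] := edge_X euc uS.
  by rewrite cofacetX // (le_X_trans uX cX xX euc).
Qed.

(** What survives is complete bipartite on the class and its partners, so an independent set stays
    on one side. *)
Lemma link_cofacet : is_two_simplices (link (Ind e) F) (cls x) (m @: cls x).
Proof.
have clsX c : c \in cls x -> c \in X by case/clsP.
have clsS c : c \in cls x -> c \in S by move=> /clsX/in_X[].
have mclsS v : v \in m @: cls x -> v \notin S.
  by case/imsetP=> c /clsX/in_X[_ ? _] ->.
split=> [|H].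
  rewrite disjoint_subset; apply/subsetP => c /clsS cS.
  by apply: contraL cS => /mclsS.
rewrite link_Ind; last exact: cofacet_Ind.
have -> : outside F = cls x :|: m @: cls x by apply/setP/outside_cofacet.
apply/andP/orP => [[/subsetP Hsub /forall_inP He]|].
  have [|/subsetPn[v vH vc]] := boolP (H \subset cls x); first by left.
  right; apply/subsetP => w wH.
  case/setUP: (Hsub v vH) => [|/imsetP[c cc vE]]; first by rewrite (negPf vc).
  case/setUP: (Hsub w wH) => // wc; have /forall_inP/(_ v vH) := He w wH.
  by rewrite vE (cls_le xX wc cc).
have edgeS u v : (u \in S) = (v \in S) -> ~~ e u v.
  by move=> uv; apply/negP => /bip; rewrite uv; case: (v \in S).
case=> /subsetP Hsub; split.
- by apply/subsetP => v /Hsub vc; rewrite inE vc.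
- apply/forall_inP => u /Hsub/clsS uS; apply/forall_inP => v /Hsub/clsS vS.
  by apply: edgeS; rewrite uS.
- by apply/subsetP => v /Hsub vc; rewrite inE vc orbT.
- apply/forall_inP => u /Hsub/mclsS uS; apply/forall_inP => v /Hsub/mclsS vS.
  by apply: edgeS; rewrite (negPf uS) (negPf vS).
Qed.

End Cofacet.

(** Every edge has an end in [X], so the subgraph lies within the class of some [x]; by maximality
    they have the same vertices, and [n] follows by counting. *)
Lemma maximal_Knn_cls n A B : 0 < n -> maximal_Knn e n A B ->
  exists2 x, x \in X & #|cls x| = n.
Proof.
move=> n0 [K maxK]; have [cA cB AB _] := K.
have /card_gt0P[a aA] : 0 < #|A| by rewrite cA.
have /card_gt0P[b bB] : 0 < #|B| by rewrite cB.
have [x xX xAB] : exists2 x, x \in X & x \in A :|: B.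
  case/orP: (edge_cases (AB a b aA bB)) => /andP[vX _].
    by exists a; rewrite // inE aA.
  by exists b; rewrite // inE bB orbT.
exists x => //; have := maxK _ _ _ (cls_Knn xX) (is_Knn_subU K xX xAB).
have dAB : A :&: B = set0.
  apply/eqP; rewrite -subset0; apply/subsetP => v /setIP[vA vB].
  by have := AB v v vA vB; rewrite e_irr.
have [dis _] := link_cofacet xX; move/(congr1 (fun C : {set V} => #|C|)).
rewrite !cardsU dAB (disjoint_setI0 dis) cards0 !subn0 cA cB.
rewrite card_imset; last exact: can_inj mK.
lia.
Qed.

End Graph.

Theorem theorem4p1 (k : fieldType) (V : finType) (e : rel V) (d n : nat)
    (A B : {set V}) :
  simple_graph e ->
  unmixed e ->
  bipartite e ->
  gdim e = (d%:Z - 1)%R ->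
  ~ graph_CM e k ->
  min_maximal_Knn e n A B ->
  graph_CM_t e k (d - n + 1) /\ ~ graph_CM_t e k (d - n).
Proof.
case=> e_sym e_irr unm [V1 [V2 [V12 V12T bip]]] gd _ [n2 maxK minK].
have eV1 u v : e u v -> (u \in V1) = (v \notin V1).
  have V12P w : (w \in V2) = (w \notin V1).
    have /setP/(_ w) := V12; have /setP/(_ w) := V12T; rewrite !inE.
    by case: (w \in V1) (w \in V2) => [] [].
  by move/bip; rewrite !V12P; case: (u \in V1) (v \in V1) => [] [].
(* The matching is the one that comes with the given complete bipartite subgraph. *)
have [[_ _ _ [m0 pm0 _]] _] := maxK.
have [m mK em0] := perfect_matching_involutive e_sym pm0.
have em u v : e u v -> e u (m u) by case/em0.
have dE := gdim_card e_sym eV1 mK em gd.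
split; [split=> // F FI Ft|case=> _ nCM].
  apply: (@link_CM _ _ e_sym e_irr V1 m eV1 mK em unm k n F FI).
    move=> x xX cls2; apply: minK cls2 _.
    exact: (cls_maximal e_sym e_irr eV1 mK em unm xX).
  (* Subtraction is truncated, but [d - n + 1 <= #|F|] gives [d < #|F| + n] also when [d < n]. *)
  by rewrite -dE; lia.
have [x xX clsn] := maximal_Knn_cls e_sym e_irr eV1 mK em unm (ltnW n2) maxK.
have two := link_cofacet e_sym e_irr eV1 mK em unm xX.
apply: (two_simplices_not_CM (k := k) two); rewrite ?clsn //.
  by apply/card_gt0P; exists (m x); rewrite imset_f //; apply: (cls_self eV1 xX).
(* The cofacet has at least [d - n] vertices, so its link would have to be Cohen-Macaulay. *)
apply: nCM; first exact: (cofacet_Ind e_sym e_irr eV1 mK em unm xX).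
by have := cofacet_card eV1 mK x; rewrite -dE clsn; lia.
Qed.
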